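(* There is an algorithm which, given a bipartite graph $G=(V_1\cup V_2,E)$ with $|V_1|=|V_2|=n$ and average degree $\Delta\ge 3$ (i.e. $|E|=\Delta n$), computes the number of perfect matchings of $G$ in time $O^{\ast}\!\left(2^{\left(1-\frac{1}{5\Delta\log\Delta}\right)n}\right)$, using exponential space.
   Context: A perfect matching of a graph is a set of edges such that every vertex is incident to exactly one of them. $O^{\ast}(f(n))$ denotes $O(f(n)\cdot\mathrm{poly}(n))$, i.e. big-O with polynomial factors in $n$ suppressed. The average degree of a graph with vertex set $V$ and edge set $E$ is $2|E|/|V|$. *)

(* Defs.v *)
From HB Require Import structures.
From mathcomp Require Import all_boot all_order all_algebra.
From mathcomp Require Import reals exp.

Set Implicit Arguments.
Unset Strict Implicit.
Unset Printing Implicit Defensive.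

Import Order.TTheory GRing.Theory Num.Theory.

(** Bipartite graphs with V1 = V2 = {0, ..., n-1} (as disjoint copies).  The
    pair (i, j) is the edge joining i in V1 to j in V2. *)

Definition vertex (n : nat) := ('I_n + 'I_n)%type.

Definition bigraph (n : nat) := {set 'I_n * 'I_n}.

Definition incident n (v : vertex n) (e : 'I_n * 'I_n) : bool :=
  match v with inl i => e.1 == i | inr j => e.2 == j end.

Definition perfect_matching n (E M : bigraph n) : bool :=
  (M \subset E) && [forall v : vertex n, #|[set e in M | incident v e]| == 1].

Definition perfect_matchings n (E : bigraph n) : {set bigraph n} :=
  [set M | perfect_matching E M].

Definition avg_degree (R : realType) n (E : bigraph n) : R :=
  (2 * #|E|%:R / #|{: vertex n}|%:R)%R.

Definition log2 (R : realType) (x : R) : R := (ln x / ln 2)%R.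

(** Random access machines over nat under the logarithmic cost criterion,
    presented as structured programs.  A location is a register [inl r], named
    statically in the program, or a memory cell [inr a], whose address may be
    computed at run time. *)

Definition loc := (nat + nat)%type.

Definition state := loc -> nat.

Definition upd (s : state) (l : loc) (v : nat) : state :=
  fun l' => if l' == l then v else s l'.

Inductive binop := Add | Sub | Mul | Div.

Inductive expr :=
  | Cst of nat
  | Reg of nat
  | Mem of expr
  | Op of binop & expr & expr.

Inductive cmd :=
  | Skip
  | SetReg of nat & expr
  | SetMem of expr & expr
  | Seq of cmd & cmd
  | If of expr & cmd & cmd
  | While of expr & cmd.

(* Number of binary digits, with [bitlen 0 = 1]. *)
Definition bitlen (n : nat) : nat := (trunc_log 2 n).+1.

Definition loc_len (l : loc) : nat :=
  match l with inl r => bitlen r | inr a => bitlen a end.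

Definition access_cost (l : loc) (v : nat) : nat := loc_len l + bitlen v.

(* [Sub] is truncated at 0, and [Div] by 0 returns 0. *)
Definition binop_eval (o : binop) (a b : nat) : nat :=
  match o with
  | Add => a + b
  | Sub => a - b
  | Mul => a * b
  | Div => a %/ b
  end.

(* Multiplication and division are charged the schoolbook bit cost, so that no
   super-polynomial speed-up can be hidden in arithmetic on long numbers. *)
Definition binop_cost (o : binop) (a b : nat) : nat :=
  match o with
  | Add | Sub => bitlen a + bitlen b
  | Mul | Div => bitlen a * bitlen b
  end.

Fixpoint eval (s : state) (e : expr) : nat :=
  match e with
  | Cst k => k
  | Reg r => s (inl r)
  | Mem a => s (inr (eval s a))
  | Op o e1 e2 => binop_eval o (eval s e1) (eval s e2)
  end.

Fixpoint expr_cost (s : state) (e : expr) : nat :=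
  match e with
  | Cst k => bitlen k
  | Reg r => access_cost (inl r) (s (inl r))
  | Mem a =>
      let l := inr (eval s a) in expr_cost s a + access_cost l (s l)
  | Op o e1 e2 =>
      expr_cost s e1 + expr_cost s e2 + binop_cost o (eval s e1) (eval s e2)
  end.

(* A trace lists the accesses to the store, each with the value read or
   written. *)
Definition trace := seq (loc * nat).

Fixpoint expr_trace (s : state) (e : expr) : trace :=
  match e with
  | Cst _ => [::]
  | Reg r => [:: (inl r, s (inl r))]
  | Mem a =>
      let l := inr (eval s a) in rcons (expr_trace s a) (l, s l)
  | Op _ e1 e2 => expr_trace s e1 ++ expr_trace s e2
  end.

(* [exec c s s' t tr]: started in [s], the program [c] halts in [s'] after time
   [t], with trace [tr].  A test succeeds when its value is nonzero. *)
Inductive exec : cmd -> state -> state -> nat -> trace -> Prop :=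
  | ExecSkip s : exec Skip s s 1 [::]
  | ExecSetReg s r e :
      let l := inl r in let v := eval s e in
      exec (SetReg r e) s (upd s l v)
           (expr_cost s e + access_cost l v)
           (rcons (expr_trace s e) (l, v))
  | ExecSetMem s a e :
      let l := inr (eval s a) in let v := eval s e in
      exec (SetMem a e) s (upd s l v)
           (expr_cost s a + expr_cost s e + access_cost l v)
           (rcons (expr_trace s a ++ expr_trace s e) (l, v))
  | ExecSeq c1 c2 s s1 s2 t1 t2 tr1 tr2 :
      exec c1 s s1 t1 tr1 -> exec c2 s1 s2 t2 tr2 ->
      exec (Seq c1 c2) s s2 (t1 + t2) (tr1 ++ tr2)
  | ExecIfTrue e c1 c2 s s' t tr :
      eval s e != 0 -> exec c1 s s' t tr ->
      exec (If e c1 c2) s s' (expr_cost s e + t) (expr_trace s e ++ tr)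
  | ExecIfFalse e c1 c2 s s' t tr :
      eval s e = 0 -> exec c2 s s' t tr ->
      exec (If e c1 c2) s s' (expr_cost s e + t) (expr_trace s e ++ tr)
  | ExecWhileTrue e c s s1 s2 t1 t2 tr1 tr2 :
      eval s e != 0 -> exec c s s1 t1 tr1 ->
      exec (While e c) s1 s2 t2 tr2 ->
      exec (While e c) s s2 (expr_cost s e + t1 + t2)
           (expr_trace s e ++ tr1 ++ tr2)
  | ExecWhileFalse e c s :
      eval s e = 0 -> exec (While e c) s s (expr_cost s e) (expr_trace s e).

(* Space under the logarithmic cost criterion: each location ever accessed counts for the length of its
   name plus the length of the longest value it is seen to hold. *)
Definition ram_space (tr : trace) : nat :=
  \sum_(l <- undup (unzip1 tr))
    (loc_len l + \max_(x <- tr | x.1 == l) bitlen x.2).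

(* Register 0 holds n, memory cells 0, ..., n^2 - 1 hold the biadjacency matrix
   row by row, and every other location holds 0. *)
Definition input n (E : bigraph n) : state := fun l =>
  match l with
  | inl r => if r == 0 then n else 0
  | inr a =>
      [exists i : 'I_n, exists j : 'I_n, (a == i * n + j) && ((i, j) \in E)]
  end.

Definition output (s : state) : nat := s (inl 0).

(* Main.v *)
Require Import Defs.
From HB Require Import structures.
From mathcomp Require Import all_boot all_order all_algebra.
From mathcomp Require Import boolp reals exp.
From mathcomp Require Import zify ring lra.
Require Import Defs.

(** Dynamic programming over column sets: process the rows of V1 one at a time
    and record, for each set X of columns, the number of ways to match the rows
    seen so far onto X.  Among the columns of degree at most 3 Delta / 2, choose a
    set S of about n / (5 Delta); its neighbourhood A has at most 3 n / 10 rows.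
    Process the rows of A first.  During this phase only sets X with at most
    3 n / 10 elements occur, i.e. at most C(n, |X|) <= 2^(9n/10) per row.  Once A is
    exhausted, a set that misses a column of S can never be completed, so only the
    2^(n - |S|) sets containing S are kept.  The nonzero entries of each layer are
    kept in a queue, so the time is proportional to the number of sets that occur;
    the space is bounded by the time, because the logarithmic cost charges every
    access. *)

Set Implicit Arguments.
Unset Strict Implicit.
Unset Printing Implicit Defensive.

(** The size of [S] balances two demands. A larger [S] saves more in the second phase, which costs
    about 2^(n - |S|), but it also enlarges the neighbourhood, and the first phase beats 2^n only
    while |A| stays a fixed fraction below n/2. With |S| about n / (5 Delta) and degrees at most 3
    Delta / 2, the first phase costs at most 2^(9n/10). As Delta >= 3, this is below the cost 2^((1
    - 1/(5 Delta)) n) of the second phase. What is obtained is thus a bound without the logarithm;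
    the stated one follows from log Delta >= 1.

    The machine computes with natural numbers only, so every threshold involving Delta = |E| / n is
    cleared of denominators. The set [S] is chosen greedily by the program itself, and the analysis
    must hold for whichever set the greedy choice produces. *)

(** * Bit lengths *)

Lemma bitlen_leE L x : 0 < L -> (bitlen x <= L) = (x < 2 ^ L).
Proof.
move=> L0; rewrite /bitlen; case: (posnP x) => [->|x0].
  by rewrite trunc_log0 L0 expn_gt0.
apply/idP/idP => [lt_xL|].
  by apply: leq_trans (trunc_log_ltn x (isT : 1 < 2)) _; rewrite leq_exp2l.
by move=> ltxL; rewrite -(@ltn_exp2l 2) // (leq_ltn_trans _ ltxL) ?trunc_logP.
Qed.

Lemma ltn_exp_bitlen x : x < 2 ^ bitlen x.
Proof. by rewrite -bitlen_leE. Qed.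

Lemma bitlen_leS x : bitlen x <= x.+1.
Proof. by rewrite bitlen_leE // (ltn_trans (ltnSn x)) // ltn_expl. Qed.

Lemma leq_bitlen x y : x <= y -> bitlen x <= bitlen y.
Proof. by move=> xy; rewrite bitlen_leE //; apply: leq_ltn_trans (ltn_exp_bitlen y). Qed.

Lemma bitlen_binop o a b : bitlen (binop_eval o a b) <= bitlen a + bitlen b.
Proof.
have [ha hb] := (ltn_exp_bitlen a, ltn_exp_bitlen b).
case: o => /=.
- rewrite bitlen_leE // expnD.
  (* Bit lengths are at least 1, so both powers are at least 2 and their sum is at most their
     product. *)
  have : 2 ^ 1 <= 2 ^ bitlen a by rewrite leq_exp2l.
  have : 2 ^ 1 <= 2 ^ bitlen b by rewrite leq_exp2l.
  nia.
- by apply: leq_trans (leq_addr _ _); apply/leq_bitlen/leq_subr.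
- by rewrite bitlen_leE // expnD ltn_mul.
- by apply: leq_trans (leq_addr _ _); apply/leq_bitlen/leq_div.
Qed.

(** * Space is bounded by time *)

Definition trace_cost (tr : trace) := \sum_(x <- tr) access_cost x.1 x.2.

Lemma trace_cost_cat tr1 tr2 :
  trace_cost (tr1 ++ tr2) = trace_cost tr1 + trace_cost tr2.
Proof. by rewrite /trace_cost big_cat. Qed.

Lemma trace_cost_rcons tr x :
  trace_cost (rcons tr x) = trace_cost tr + access_cost x.1 x.2.
Proof. by rewrite -cats1 trace_cost_cat /trace_cost big_seq1. Qed.

Lemma trace_cost_expr s e : trace_cost (expr_trace s e) <= expr_cost s e.
Proof.
elim: e => [k|r|a IH|o e1 IH1 e2 IH2] /=.
- by rewrite /trace_cost big_nil.
- by rewrite /trace_cost big_seq1.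
- by rewrite trace_cost_rcons leq_add2r.
- by rewrite trace_cost_cat; apply: leq_trans (leq_add IH1 IH2) (leq_addr _ _).
Qed.

Lemma trace_cost_exec c s s' t tr : exec c s s' t tr -> trace_cost tr <= t.
Proof.
elim=> {c s s' t tr}
  [s|s r e l v|s a e l v|c1 c2 s s1 s2 t1 t2 tr1 tr2 _ IH1 _ IH2
  |e c1 c2 s s' t tr _ _ IH|e c1 c2 s s' t tr _ _ IH
  |e c s s1 s2 t1 t2 tr1 tr2 _ _ IH1 _ IH2|e c s _].
- by rewrite /trace_cost big_nil.
- by rewrite trace_cost_rcons leq_add2r trace_cost_expr.
- by rewrite trace_cost_rcons leq_add2r trace_cost_cat leq_add ?trace_cost_expr.
- by rewrite trace_cost_cat leq_add.
- by rewrite trace_cost_cat leq_add ?trace_cost_expr.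
- by rewrite trace_cost_cat leq_add ?trace_cost_expr.
- by rewrite !trace_cost_cat -addnA !leq_add ?trace_cost_expr.
- exact: trace_cost_expr.
Qed.

(** The name of a location is paid for by one of its accesses, its longest value by the sum over all
    of them. Exchanging the sums then counts each access once, at its own location. *)
Lemma ram_space_leq_cost tr : ram_space tr <= trace_cost tr.
Proof.
rewrite /ram_space /trace_cost.
apply: (@leq_trans (\sum_(l <- undup (unzip1 tr))
          \sum_(x <- tr | x.1 == l) access_cost x.1 x.2)).
  rewrite big_seq_cond [X in _ <= X]big_seq_cond.
  apply: leq_sum => l; rewrite andbT mem_undup => /mapP [x0 x0tr ->] {l}.
  rewrite /access_cost big_split leq_add //=.
    by rewrite (big_rem x0) //= eqxx leq_addr.
  by elim/big_rec2: _ => // x m1 m2 _ /= le12; rewrite geq_max leq_addr (leq_trans le12) ?leq_addl.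
rewrite (exchange_big_dep predT) //= big_seq_cond [X in _ <= X]big_seq_cond.
apply: leq_sum => x /andP [xtr _].
rewrite (eq_bigl (pred1 x.1)) => [|l]; last by rewrite /= eq_sym.
by rewrite -big_filter filter_pred1_uniq ?undup_uniq ?mem_undup ?map_f // big_seq1.
Qed.

Lemma ram_space_exec c s s' t tr : exec c s s' t tr -> ram_space tr <= t.
Proof. by move=> /trace_cost_exec; apply: leq_trans (ram_space_leq_cost tr). Qed.

(** * A cost-annotated program logic *)

(* In units of a common bound L on the bit length of all stored values,
   [expr_width] bounds the bit length of the value of an expression; [expr_weight]
   and [cmd_weight] bound the cost of one evaluation or one step in units of L^2. *)
Fixpoint expr_width (e : expr) : nat :=
  match e with
  | Cst k => k.+1
  | Reg _ | Mem _ => 1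
  | Op _ e1 e2 => expr_width e1 + expr_width e2
  end.

Fixpoint expr_weight (e : expr) : nat :=
  match e with
  | Cst k => k.+1
  | Reg r => r.+2
  | Mem a => expr_weight a + (expr_width a + 1)
  | Op _ e1 e2 => expr_weight e1 + expr_weight e2 + (expr_width e1 + expr_width e2 + expr_width e1 * expr_width e2)
  end.

Fixpoint cmd_weight (c : cmd) : nat :=
  match c with
  | Skip => 1
  | SetReg r e => expr_weight e + r.+2
  | SetMem a e => expr_weight a + expr_weight e + (expr_width a + 1)
  | Seq c1 c2 => maxn (cmd_weight c1) (cmd_weight c2)
  | If e c1 c2 => maxn (expr_weight e) (maxn (cmd_weight c1) (cmd_weight c2))
  | While e c => maxn (expr_weight e) (cmd_weight c)
  end.

(** The truncated difference is nonzero exactly while the counter is below the bound. The bound [b]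
    is evaluated anew at every test, so the body must preserve its value. *)
Definition For (r : nat) (b : expr) (c : cmd) : cmd :=
  Seq (SetReg r (Cst 0))
      (While (Op Sub b (Reg r)) (Seq c (SetReg r (Op Add (Reg r) (Cst 1))))).

Section Run.

Variables L W : nat.
Hypothesis L_gt0 : 0 < L.

Definition bnd (s : state) := forall l, bitlen (s l) <= L.

(** Only stored values obey the bound [L]. Intermediate values may be longer, but by a factor fixed
    by the program text. *)
Lemma expr_widthP s e : bnd s -> bitlen (eval s e) <= expr_width e * L.
Proof.
move=> bs; elim: e => [k|r|a _|o e1 IH1 e2 IH2] /=; rewrite ?mul1n //.
  by rewrite (leq_trans (bitlen_leS k)) // leq_pmulr.
by rewrite (leq_trans (bitlen_binop o _ _)) // mulnDl leq_add.
Qed.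

Lemma expr_weightP s e : bnd s -> expr_cost s e <= expr_weight e * L ^ 2.
Proof.
move=> bs; have LL : L <= L ^ 2 by rewrite -mulnn leq_pmulr.
have L1 : 0 < L ^ 2 by rewrite expn_gt0 L_gt0.
elim: e => [k|r|a IH|o e1 IH1 e2 IH2] /=.
- by rewrite (leq_trans (bitlen_leS k)) // leq_pmulr.
- have := bitlen_leS r; have := bs (inl r); rewrite /access_cost /=; nia.
- have := expr_widthP a bs; have := bs (inr (eval s a)); rewrite /access_cost /=; nia.
- have := expr_widthP e1 bs; have := expr_widthP e2 bs.
  set a := bitlen _; set b := bitlen _ => hb ha.
  have hab : a * b <= expr_width e1 * expr_width e2 * L ^ 2.
    by rewrite -mulnn mulnACA mulnC leq_mul.
  have -> : (expr_weight e1 + expr_weight e2 + (expr_width e1 + expr_width e2 + expr_width e1 * expr_width e2)) * L ^ 2 =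
     expr_weight e1 * L ^ 2 + expr_weight e2 * L ^ 2 + (expr_width e1 + expr_width e2 + expr_width e1 * expr_width e2) * L ^ 2.
    by rewrite !mulnDl.
  rewrite leq_add ?leq_add //.
  case: o => /=; rewrite -/a -/b; nia.
Qed.

(* [N] counts elementary steps, each charged at most W * L^2. *)
Definition run (c : cmd) (s : state) (N : nat) (Q : state -> Prop) :=
  bnd s -> cmd_weight c <= W ->
  exists s' t tr, [/\ exec c s s' t tr, t <= N * (W * L ^ 2), bnd s' & Q s'].

Lemma bnd_upd s l v : bnd s -> v < 2 ^ L -> bnd (upd s l v).
Proof. by move=> bs hv l'; rewrite /upd; case: eqP => // _; rewrite bitlen_leE. Qed.

Lemma run_weaken c s N N' (Q Q' : state -> Prop) :
  run c s N Q -> N <= N' -> (forall s, bnd s -> Q s -> Q' s) -> run c s N' Q'.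
Proof.
move=> rc NN QQ bs fc; have [s' [t [tr [ex lt b' q]]]] := rc bs fc.
exists s', t, tr; split=> //; last exact: QQ.
by apply: leq_trans lt _; rewrite leq_mul2r NN orbT.
Qed.

Lemma run_skip s (Q : state -> Prop) : Q s -> run Skip s 1 Q.
Proof.
move=> q bs /= W1; exists s, 1, [::]; split=> //; first exact: ExecSkip.
by rewrite mul1n muln_gt0 W1 expn_gt0 L_gt0.
Qed.

Lemma run_set r e s (Q : state -> Prop) :
  eval s e < 2 ^ L -> Q (upd s (inl r) (eval s e)) -> run (SetReg r e) s 1 Q.
Proof.
move=> lv q bs /= fc; do 3 eexists; split; [exact: ExecSetReg| |exact: bnd_upd|by []].
rewrite mul1n (leq_trans _ (leq_mul fc (leqnn _))) // mulnDl leq_add ?expr_weightP //.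
rewrite /access_cost /=; move: lv; rewrite -bitlen_leE // => lv.
by have := bitlen_leS r; rewrite -mulnn; nia.
Qed.

Lemma run_setmem a e s (Q : state -> Prop) :
  eval s e < 2 ^ L -> Q (upd s (inr (eval s a)) (eval s e)) ->
  run (SetMem a e) s 1 Q.
Proof.
move=> lv q bs /= fc; do 3 eexists; split; [exact: ExecSetMem| |exact: bnd_upd|by []].
rewrite mul1n (leq_trans _ (leq_mul fc (leqnn _))) // !mulnDl !leq_add ?expr_weightP //.
  by rewrite (leq_trans (expr_widthP a bs)) // leq_mul2l -mulnn leq_pmulr ?orbT.
by rewrite mul1n; move: lv; rewrite -bitlen_leE // => lv; rewrite (leq_trans lv) // -mulnn leq_pmulr.
Qed.

(** The postcondition of the first command is the triple of the second, so programs are verified by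
    forward symbolic execution. *)
Lemma run_seq N1 N2 c1 c2 s (Q : state -> Prop) :
  run c1 s N1 (fun s1 => run c2 s1 N2 Q) -> run (Seq c1 c2) s (N1 + N2) Q.
Proof.
move=> r1 bs /=; rewrite geq_max => /andP [f1 f2].
have [s1 [t1 [tr1 [ex1 lt1 b1 r2]]]] := r1 bs f1.
have [s2 [t2 [tr2 [ex2 lt2 b2 q]]]] := r2 b1 f2.
exists s2, (t1 + t2), (tr1 ++ tr2); split=> //; first exact: ExecSeq ex1 ex2.
by rewrite mulnDl leq_add.
Qed.

Lemma run_if N e c1 c2 s (Q : state -> Prop) :
  (if eval s e != 0 then run c1 s N Q else run c2 s N Q) ->
  run (If e c1 c2) s N.+1 Q.
Proof.
move=> r bs /=; rewrite !geq_max => /and3P [fe f1 f2].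
have le : expr_cost s e <= W * L ^ 2.
  by rewrite (leq_trans (expr_weightP e bs)) // leq_mul2r fe orbT.
case: eqP r => /= [e0|/eqP e0] r.
  have [s' [t [tr [ex lt b' q]]]] := r bs f2.
  do 3 eexists; split; [exact: ExecIfFalse e0 ex| |by []|by []].
  by rewrite mulSn leq_add.
have [s' [t [tr [ex lt b' q]]]] := r bs f1.
do 3 eexists; split; [exact: ExecIfTrue e0 ex| |by []|by []].
by rewrite mulSn leq_add.
Qed.

(** The invariant is indexed by the number of completed rounds. Each round pays one test besides its
    body, and the last unit is the failing test. *)
Lemma run_while (I : nat -> state -> Prop) m Nb e c s :
  (forall k s, k <= m -> I k s -> (eval s e != 0) = (k < m)) ->
  (forall k s, k < m -> I k s -> run c s Nb (I k.+1)) ->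
  I 0 s -> run (While e c) s (m * Nb.+1).+1 (I m).
Proof.
move=> He Hc I0 bs /=; rewrite geq_max => /andP [fe fc].
have le s0 : bnd s0 -> expr_cost s0 e <= W * L ^ 2.
  by move=> b0; rewrite (leq_trans (expr_weightP e b0)) // leq_mul2r fe orbT.
suff loop d k s0 : k + d = m -> I k s0 -> bnd s0 -> exists s' t tr,
    [/\ exec (While e c) s0 s' t tr, t <= (d * Nb.+1).+1 * (W * L ^ 2), bnd s' & I m s'].
  exact: loop I0 bs.
elim: d k s0 => [|d IH] k s0 km Ik b0.
  rewrite addn0 in km; subst k; exists s0, (expr_cost s0 e), (expr_trace s0 e).
  split=> //; last by rewrite mul0n mul1n le.
  by apply: ExecWhileFalse; apply/eqP; apply: negbFE; rewrite (He m) ?ltnn.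
have km' : k < m by rewrite -km addnS ltnS leq_addr.
have [s1 [t1 [tr1 [ex1 lt1 b1 I1]]]] := Hc k s0 km' Ik b0 fc.
have [|s2 [t2 [tr2 [ex2 lt2 b2 I2]]]] := IH k.+1 s1 _ I1 b1; first by rewrite addSnnS.
do 3 eexists; split; [apply: ExecWhileTrue ex1 ex2| |by []|by []].
  by rewrite (He k) // ltnW.
have -> : (d.+1 * Nb.+1).+1 = 1 + Nb + (d * Nb.+1).+1 by lia.
by rewrite !mulnDl mul1n !leq_add ?le.
Qed.

(** Test and increment add two units per round; the outer two are the initialisation and the failing
    test. The counter reaches [m], hence the bound on [m]. *)
Lemma run_for (I : nat -> state -> Prop) m Nb r b c s :
  m < 2 ^ L ->
  (forall k s, k <= m -> I k s -> eval s b = m /\ s (inl r) = k) ->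
  (forall k s, k < m -> I k s ->
     run c s Nb (fun s' => s' (inl r) = k /\ I k.+1 (upd s' (inl r) k.+1))) ->
  I 0 (upd s (inl r) 0) -> run (For r b c) s (m * Nb.+2).+2 (I m).
Proof.
move=> mL Hb Hc I0; apply: (@run_seq 1 (m * Nb.+2).+1).
apply: run_set; first by rewrite /= expn_gt0.
apply: run_while => // [k s' km Ik|k s' km Ik].
  by have [e1 e2] := Hb k s' km Ik; rewrite /= e1 e2 subn_eq0 -ltnNge.
rewrite -[Nb.+1]addn1; apply: run_seq; apply: run_weaken; [exact: Hc km Ik|by []|].
move=> s1 b1 [sk Ik1]; apply: run_set => /=; rewrite sk addn1 //.
exact: leq_ltn_trans mL.
Qed.

End Run.

(** * Matchings between a set of rows and a set of columns *)

Lemma card_sepU1 (T : finType) (e0 : T) (M : {set T}) (P : pred T) :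
  e0 \notin M ->
  #|[set e in e0 |: M | P e]| = P e0 + #|[set e in M | P e]|.
Proof.
move=> e0M; case: (boolP (P e0)) => P0.
  have -> : [set e in e0 |: M | P e] = e0 |: [set e in M | P e].
    by apply/setP=> e; rewrite !inE; case: eqVneq => [->|].
  by rewrite cardsU1 inE (negbTE e0M).
rewrite add0n; apply: eq_card => e; rewrite !inE.
by case: eqVneq => [->|] //; rewrite (negbTE P0) andbF (negbTE e0M).
Qed.

Section Matchings.

Variables (n : nat) (E : bigraph n).

(** Read as a number, the membership bit asks for degree 1 inside [R] or [X] and degree 0 outside:
    these are the matchings of exactly the rows [R] onto exactly the columns [X]. *)
Definition matchings (R X : {set 'I_n}) : {set bigraph n} :=
  [set M : bigraph n | [&& M \subset E,
     [forall i, #|[set e in M | e.1 == i]| == (i \in R)] &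
     [forall j, #|[set e in M | e.2 == j]| == (j \in X)]]].

Lemma matchingsP (R X : {set 'I_n}) (M : bigraph n) :
  reflect [/\ M \subset E, forall i, #|[set e in M | e.1 == i]| = (i \in R)
           & forall j, #|[set e in M | e.2 == j]| = (j \in X)]
          (M \in matchings R X).
Proof.
rewrite inE; apply: (iffP and3P) => [[ME /forallP H1 /forallP H2]|[ME H1 H2]].
  by split=> // i; apply/eqP.
by split=> //; apply/forallP => i; apply/eqP.
Qed.

Lemma matchings_full : matchings setT setT = perfect_matchings E.
Proof.
apply/setP=> M; rewrite [in RHS]inE /perfect_matching.
apply/matchingsP/andP => [[ME H1 H2]|[ME /forallP H]].
  by split=> //; apply/forallP => -[i|j]; rewrite /= ?H1 ?H2 inE.
split=> // i; first by rewrite inE; apply/eqP/(H (inl i)).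
by rewrite inE; apply/eqP/(H (inr i)).
Qed.

Lemma card_fibers (T : finType) (M : {set T}) (f : T -> 'I_n) (Y : {set 'I_n}) :
  (forall i, #|[set e in M | f e == i]| = (i \in Y)) -> #|M| = #|Y|.
Proof.
move=> H; rewrite -sum1_card (partition_big f predT) //= -[RHS]sum1_card.
rewrite [RHS]big_mkcond; apply: eq_bigr => i _.
rewrite -[RHS]/(nat_of_bool (i \in Y)) -H -sum1_card.
by apply: eq_bigl => e; rewrite inE.
Qed.

(** A matching pairs the rows with the columns. This confines each layer of the dynamic program to
    sets of a single size. *)
Lemma matchings_card (R X : {set 'I_n}) : #|matchings R X| != 0 -> #|X| = #|R|.
Proof.
rewrite cards_eq0 => /set0Pn [M /matchingsP [_ H1 H2]].
by rewrite -(card_fibers H1) -(card_fibers H2).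
Qed.

Lemma matchings0 (X : {set 'I_n}) : #|matchings set0 X| = (X == set0).
Proof.
case: eqVneq => [->|X0]; last first.
  apply/eqP; apply: contraNT X0 => /matchings_card.
  by rewrite cards0 => /eqP; rewrite cards_eq0.
rewrite (_ : matchings set0 set0 = [set set0]) ?cards1 //; apply/setP=> M.
rewrite in_set1; apply/matchingsP/eqP => [[_ H1 _]|->].
  by apply/eqP; rewrite -cards_eq0 (card_fibers H1) cards0.
split; first exact: sub0set.
  by move=> i; rewrite inE; apply: eq_card0 => e; rewrite !inE.
by move=> i; rewrite inE; apply: eq_card0 => e; rewrite !inE.
Qed.

(** Crude, but enough to keep every count within n^2 + 1 bits, so that arithmetic stays
    polynomial. *)
Lemma matchings_bound (R X : {set 'I_n}) : #|matchings R X| <= 2 ^ (n * n).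
Proof.
apply: leq_trans (max_card _) _.
by rewrite -cardsT -powersetT card_powerset cardsT card_prod card_ord.
Qed.

(** Adding and deleting the edge (r, j) are mutually inverse: as [r] lies outside [R], no smaller
    matching already contains that edge. *)
Lemma matchingsU1 (R X : {set 'I_n}) (r j : 'I_n) : r \notin R ->
  [set M in matchings (r |: R) X | (r, j) \in M] =
  if (j \in X) && ((r, j) \in E)
  then [set (r, j) |: M | M in matchings R (X :\ j)] else set0.
Proof.
move=> rR; apply/setP => M; rewrite inE.
apply/andP/idP => [[/matchingsP [ME H1 H2] rjM]|].
  have jX : j \in X.
    have: #|[set e in M | e.2 == j]| != 0.
      by rewrite cards_eq0; apply/set0Pn; exists (r, j); rewrite inE rjM /=.
    by rewrite H2; case: (j \in X).
  rewrite jX (subsetP ME) //=; apply/imsetP; exists (M :\ (r, j)); last first.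
    by rewrite setD1K.
  have nin : (r, j) \notin M :\ (r, j) by rewrite !inE eqxx.
  apply/matchingsP; split=> [|i|k].
  - exact: subset_trans (subsetDl _ _) ME.
  - have := H1 i; rewrite -{1}(setD1K rjM) card_sepU1 //= in_setU1 eq_sym.
    by case: eqVneq => [->|] //=; rewrite (negbTE rR) add1n => -[->].
  - have := H2 k; rewrite -{1}(setD1K rjM) card_sepU1 //= in_setD1 eq_sym.
    by case: eqVneq => [->|] //=; rewrite jX add1n => -[->].
case: ifP => [/andP [jX rjE]|]; last by rewrite inE.
case/imsetP => M' /matchingsP [ME H1 H2] ->; rewrite setU11; split=> //.
have nin : (r, j) \notin M'.
  apply/negP => rj; have: #|[set e in M' | e.1 == r]| != 0.
    by rewrite cards_eq0; apply/set0Pn; exists (r, j); rewrite inE rj /=.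
  by rewrite H1 (negbTE rR).
apply/matchingsP; split=> [|i|k].
- by rewrite subUset sub1set rjE.
- rewrite card_sepU1 //= H1 in_setU1 eq_sym.
  by case: eqVneq => [->|] //=; rewrite (negbTE rR).
- rewrite card_sepU1 //= H2 in_setD1 eq_sym.
  by case: eqVneq => [->|] //=; rewrite jX.
Qed.

(** Expansion of a permanent along row [r]: each matching is counted once, at the column of its only
    edge in that row. *)
Lemma matchings_rec (R X : {set 'I_n}) (r : 'I_n) : r \notin R ->
  #|matchings (r |: R) X| =
  \sum_(j in X | (r, j) \in E) #|matchings R (X :\ j)|.
Proof.
move=> rR.
transitivity (\sum_(M in matchings (r |: R) X) \sum_(j | (r, j) \in M) 1).
  rewrite -sum1_card; apply: eq_bigr => M /matchingsP [_ H1 _].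
  transitivity #|[set e in M | e.1 == r]|; first by rewrite H1 setU11.
  rewrite sum1_card.
  have pair_inj : injective (pair r : 'I_n -> 'I_n * 'I_n) by move=> a b [].
  rewrite -(card_imset _ pair_inj); apply: eq_card => -[i j].
  rewrite inE /=; apply/andP/imsetP => [[ijM /eqP <-]|[k rk [-> ->]]]; last by rewrite eqxx.
  by exists j.
rewrite (exchange_big_dep predT) //= [RHS]big_mkcond /=; apply: eq_bigr => j _.
rewrite sum1_card.
transitivity #|[set M in matchings (r |: R) X | (r, j) \in M]|.
  by apply: eq_card => M; rewrite [RHS]inE.
rewrite matchingsU1 //; case: ifP => _; last by rewrite cards0.
apply: card_in_imset => M1 M2 /matchingsP [_ H1 _] /matchingsP [_ H2 _] eqM.
have nin (M : bigraph n) : (forall i, #|[set e in M | e.1 == i]| = (i \in R)) -> (r, j) \notin M.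
  move=> H; apply/negP => rj; have: #|[set e in M | e.1 == r]| != 0.
    by rewrite cards_eq0; apply/set0Pn; exists (r, j); rewrite inE rj /=.
  by rewrite H (negbTE rR).
by rewrite -(setU1K (nin _ H1)) eqM setU1K // nin.
Qed.

End Matchings.

(** * Bounds on the number of column sets *)

Section Counting.

Variable n : nat.

Lemma card_layer_bound (i : nat) (P : {set {set 'I_n}}) :
  (forall X, X \in P -> #|X| = i) -> #|P| <= 'C(n, i).
Proof.
move=> H; rewrite -[n in 'C(n, _)]card_ord -card_draws; apply: subset_leq_card.
by apply/subsetP => X /H XP; rewrite inE XP.
Qed.

(** The left side is a single term of the expansion of (2 + 1)^n. *)
Lemma binomial_exp2_bound i : 'C(n, i) * 2 ^ (n - i) <= 3 ^ n.
Proof.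
case: (leqP i n) => [le_in|lt_ni]; last by rewrite bin_small.
have -> : 3 ^ n = (2 + 1) ^ n by [].
rewrite expnDn (bigD1 (Ordinal (le_in : i < n.+1))) //= exp1n muln1 leq_addr //.
Qed.

(** On supersets of [S], removing [S] is injective and lands among the subsets of the complement. *)
Lemma card_supersets (S : {set 'I_n}) (P : {set {set 'I_n}}) :
  (forall X, X \in P -> S \subset X) -> #|P| <= 2 ^ (n - #|S|).
Proof.
move=> H; have -> : n - #|S| = #|~: S| by rewrite [RHS]cardsCs setCK card_ord.
rewrite -card_powerset.
have inj : {in P &, injective (fun X => X :\: S)}.
  move=> X Y /H SX /H SY eqXY.
  by rewrite -(setID X S) -(setID Y S) eqXY (setIidPr SX) (setIidPr SY).
rewrite -(card_in_imset inj); apply/subset_leq_card/subsetP => _ /imsetP [X _ ->].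
by rewrite inE setDE subsetIr.
Qed.

End Counting.

(** * Existence of a suitable set of low-degree columns *)

Section Selection.

Variables (n : nat) (E : bigraph n).

Definition deg (j : 'I_n) := #|[set e in E | e.2 == j]|.

Lemma deg_sum j : deg j = \sum_(i < n) ((i, j) \in E).
Proof.
rewrite /deg -sum1_card big_mkcond /=.
pose f (i k : 'I_n) := if (i, k) \in [set e in E | e.2 == j] then 1 else 0.
transitivity (\sum_(p : 'I_n * 'I_n) f p.1 p.2); first by apply: eq_bigr => -[].
rewrite -(pair_bigA _ f) /f /=.
apply: eq_bigr => i _; rewrite (bigD1 j) //= big1 ?addn0 => [|k kj].
  by rewrite inE eqxx andbT; case: (_ \in _).
by rewrite inE /= (negbTE kj) andbF.
Qed.

Lemma sum_deg : \sum_j deg j = #|E|.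
Proof.
rewrite -[RHS]sum1_card (partition_big snd predT) //=.
by apply: eq_bigr => j _; rewrite /deg -[LHS]sum1_card; apply: eq_bigl => e; rewrite inE.
Qed.

Definition nbr (S : {set 'I_n}) : {set 'I_n} := [set i | [exists j in S, (i, j) \in E]].

(** With |E| = Delta n, the integer conditions read deg j <= 3 Delta / 2 and |S| <= n / (5 Delta);
    the last hypothesis is greedy maximality. The neighbourhood is at most the degree sum over [S],
    which is at most n / (5 Delta) times 3 Delta / 2. *)
Lemma selection_bounds (S : {set 'I_n}) :
  0 < n -> 3 * n <= #|E| ->
  (forall j, j \in S -> 2 * deg j * n <= 3 * #|E|) ->
  5 * #|E| * #|S| <= n * n ->
  (5 * #|E| * #|S|.+1 <= n * n ->
     forall j, 2 * deg j * n <= 3 * #|E| -> j \in S) ->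
  10 * #|nbr S| <= 3 * n /\ n * n < 5 * #|E| * #|S|.+1.
Proof.
move=> n0 En goodS sS maxS.
split.
  have hA : #|nbr S| <= \sum_(j in S) deg j.
    have -> : \sum_(j in S) deg j = #|[set e in E | e.2 \in S]|.
      rewrite -[RHS]sum1_card (partition_big snd (mem S)) /=.
        apply: eq_bigr => j jS; rewrite /deg -[LHS]sum1_card; apply: eq_bigl => e.
        by rewrite !inE; case: eqVneq => [->|]; rewrite ?jS ?andbT ?andbF.
      by move=> e; rewrite inE => /andP [].
    apply: leq_trans (leq_imset_card fst _).
    apply/subset_leq_card/subsetP => i; rewrite inE => /exists_inP [j jS ijE].
    by apply/imsetP; exists (i, j); rewrite ?inE ?ijE.
  have : 2 * n * \sum_(j in S) deg j <= #|S| * (3 * #|E|).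
    rewrite -sum_nat_const big_distrr; apply: leq_sum => j /goodS; rewrite /=; lia.
  nia.
(* If there were still room, every column outside [S] would have degree above 3 Delta / 2. By the
   degree sum there are at most 2n/3 such columns, so |S| >= n/3, against |S| + 1 <= n / (5 Delta)
   <= n/15. *)
rewrite ltnNge; apply/negP => small.
have : (n - #|S|) * (3 * #|E|) <= 2 * n * #|E|.
  have -> : n - #|S| = #|~: S| by rewrite [RHS]cardsCs setCK card_ord.
  have sub : \sum_(j in ~: S) deg j <= #|E|.
    by rewrite -sum_deg [X in _ <= X](bigID (mem (~: S))) /= leq_addr.
  apply: leq_trans (leq_mul (leqnn _) sub).
  rewrite -sum_nat_const big_distrr; apply: leq_sum => j.
  rewrite inE => jS; apply: contraNT jS; rewrite -ltnNge => lt; apply: maxS => //.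
  by apply: leq_trans (ltnW lt); rewrite mulnAC.
have : #|S| <= n by rewrite -[leqRHS]card_ord max_card.
nia.
Qed.

End Selection.

(** * Column sets as bit masks *)

Section Mask.

Lemma odd_bits n (b : 'I_n -> bool) (j : 'I_n) :
  odd ((\sum_(i < n) b i * 2 ^ i) %/ 2 ^ j) = b j.
Proof.
elim: n b j => [|n IH] b j; first by case: j.
rewrite big_ord_recl muln1; under eq_bigr do rewrite expnS mulnCA.
rewrite -big_distrr /=.
case: (unliftP ord0 j) => [k|] ->; last by rewrite divn1 oddD oddM oddb addbF.
rewrite /= /bump leq0n add1n expnS divnMA -(IH (fun i => b (lift ord0 i)) k).
by congr (odd (_ %/ _)); rewrite addnC mulnC divnMDl // divn_small ?addn0 //; case: (b _).
Qed.

Variable n : nat.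
Implicit Types X : {set 'I_n}.

Definition mask (X : {set 'I_n}) : nat := \sum_(j in X) 2 ^ j.

Lemma mask_bit X (j : 'I_n) : odd (mask X %/ 2 ^ j) = (j \in X).
Proof.
rewrite -(odd_bits (fun j => j \in X)) /mask big_mkcond /=.
by congr (odd (_ %/ _)); apply: eq_bigr => i _; case: (_ \in _); rewrite ?mul1n.
Qed.

Lemma mask_inj : injective mask.
Proof. by move=> X Y eqXY; apply/setP => j; rewrite -!mask_bit eqXY. Qed.

Lemma mask0 : mask set0 = 0.
Proof. by rewrite /mask big_set0. Qed.

Lemma maskT : mask setT = 2 ^ n - 1.
Proof.
rewrite subn1 predn_exp mul1n /mask; apply: eq_bigl => i; by rewrite inE.
Qed.

Lemma mask_lt X : mask X < 2 ^ n.
Proof.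
rewrite -[2 ^ n]prednK ?expn_gt0 // ltnS -subn1 -maskT /mask.
rewrite [X in _ <= X](bigID (mem X)) /=.
rewrite [X in _ <= X + _](eq_bigl (mem X)) ?leq_addr // => i; by rewrite inE.
Qed.

Lemma maskU1 X (j : 'I_n) : j \notin X -> mask (j |: X) = mask X + 2 ^ j.
Proof. by move=> jX; rewrite /mask big_setU1 //= addnC. Qed.

End Mask.

(** * The dynamic program and its two phases *)

Section Layers.

Variables (n : nat) (E : bigraph n) (S : {set 'I_n}).
Implicit Types (X Y R : {set 'I_n}) (F : {set 'I_n} -> nat).

(* [late] is the second phase, in which the sets not containing S are dropped. *)
Definition alive (late : bool) (Y : {set 'I_n}) := late ==> (S \subset Y).

(** The filter looks at the predecessor [X :\ j], because a set is dropped when it is taken from the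
    queue, not when it is inserted. *)
Definition next late (r : 'I_n) F X : nat :=
  \sum_(j in X | ((r, j) \in E) && alive late (X :\ j)) F (X :\ j).

(* What the program has added to the entry of X after handling the first k columns
   of the queued set Y. *)
Definition contrib late (r : 'I_n) F Y (k : nat) X : nat :=
  if alive late Y then
    \sum_(j < n | [&& j < k, j \notin Y & (r, j) \in E]) (X == j |: Y) * F Y
  else 0.

Lemma contrib0 late r F Y X : contrib late r F Y 0 X = 0.
Proof. by rewrite /contrib big_pred0 // if_same. Qed.

Lemma contribS late r F Y (j : 'I_n) X :
  contrib late r F Y j.+1 X = contrib late r F Y j X +
    [&& alive late Y, j \notin Y & (r, j) \in E] * ((X == j |: Y) * F Y).
Proof.
rewrite /contrib; case: (alive late Y) => //=.
rewrite [in LHS]big_mkcond [in LHS](bigD1 j) //= ltnSn /= addnC; congr (_ + _).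
  rewrite [RHS]big_mkcond [RHS](bigD1 j) //= ltnn /= add0n.
  by apply: eq_bigr => i ij; rewrite ltnS leq_eqVlt (inj_eq val_inj) (negbTE ij).
by case: (_ && _); rewrite ?mul1n ?mul0n.
Qed.

Lemma leq_contrib late r F Y k X : contrib late r F Y k X <= contrib late r F Y n X.
Proof.
rewrite /contrib; case: ifP => // _.
rewrite big_mkcond [X in _ <= X]big_mkcond /=; apply: leq_sum => j _.
by rewrite ltn_ord; case: (j < k) => //=.
Qed.

(** The program pushes from each queued [Y] to [j |: Y], while [next] gathers over predecessors.
    They agree because, for j outside Y, X = j |: Y amounts to j in X and Y = X :\ j. *)
Lemma next_sum late r F (ls : seq {set 'I_n}) X :
  uniq ls -> (forall Y, (Y \in ls) = (F Y != 0)) ->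
  \sum_(Y <- ls) contrib late r F Y n X = next late r F X.
Proof.
move=> uls mls.
rewrite big_uniq //= (eq_bigl (fun Y => F Y != 0)) //.
transitivity (\sum_Y contrib late r F Y n X).
  rewrite big_mkcond; apply: eq_bigr => Y _; case: eqP => //= F0.
  by rewrite /contrib F0; case: ifP => // _; rewrite big1 // => j _; rewrite muln0.
rewrite /contrib -big_mkcond (exchange_big_dep predT) //= /next.
rewrite [RHS]big_mkcond; apply: eq_bigr => j _.
case: ifPn => [/and3P [jX rj al]|H].
  rewrite (bigD1 (X :\ j)) /=; last by rewrite al ltn_ord !inE eqxx rj.
  rewrite setD1K // eqxx mul1n big1 ?addn0 // => Y /andP [/and4P [_ _ jY _]].
  by case: (X =P _) => // ->; rewrite setU1K // eqxx.
rewrite big1 // => Y /and4P [al _ jY rj]; case: (X =P _) => // XY.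
by case/negP: H; rewrite XY setU11 rj setU1K.
Qed.

(** Entries under construction only grow, so they inherit the word-length bound of the finished
    layer. *)
Lemma leq_partial late r F (ls : seq {set 'I_n}) x Y0 k X :
  uniq ls -> (forall Y, (Y \in ls) = (F Y != 0)) -> x < size ls ->
  \sum_(Y <- take x ls) contrib late r F Y n X +
    contrib late r F (nth Y0 ls x) k X <= next late r F X.
Proof.
move=> uls mls xls; rewrite -(next_sum _ _ _ uls mls) -[in leqRHS](cat_take_drop x ls).
rewrite big_cat leq_add2l (drop_nth Y0) // big_cons /=.
exact: leq_trans (leq_contrib _ _ _ _ _ _) (leq_addr _ _).
Qed.

Variables (A : {set 'I_n}) (B : nat).
(** The rows handled before step [q] of two sweeps over all rows: a row i of [A] has its turn at
    step i, any other row at step i + n. *)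
Definition rows (q : nat) : {set 'I_n} :=
  [set i : 'I_n | if i \in A then i < q else i + n < q].

(** From step n on, the entry of a set missing part of [S] may be too small. The upper bound holds
    for every set and phase; it still forces the right cardinality and bounds the counts. At q = n
    both exactness clauses apply, which hands the first phase over to the second. *)
Definition layer_ok q F :=
  [/\ forall X, F X <= #|matchings E (rows q) X|,
      q <= n -> forall X, F X = #|matchings E (rows q) X|,
      n <= q -> forall X, S \subset X -> F X = #|matchings E (rows q) X|
    & #|[set X | F X != 0]| <= B].

Lemma rowsS_inactive q (r : 'I_n) : q < 2 * n -> r = q %% n :> nat ->
  (r \in A) = (n <= q) -> rows q.+1 = rows q.
Proof.
move=> q2 rq rA; apply/setP => i; rewrite !inE ltnS (leq_eqVlt _ q) [i + n < _]ltnS.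
case: (leqP n q) rA => nq rA.
  have qr : q = r + n by rewrite rq -{2}(subnK nq) modnDr modn_small; lia.
  case: ifP => iA; first by have := ltn_ord i; lia.
  case: (eqVneq i r) iA => [->|ir]; first by rewrite rA.
  have : nat_of_ord i != r by [].
  lia.
have qr : q = r by rewrite rq modn_small.
case: ifP => iA; last by lia.
case: (eqVneq i r) iA => [->|ir]; first by rewrite rA.
have : nat_of_ord i != r by [].
lia.
Qed.

Lemma rowsS_active q (r : 'I_n) : q < 2 * n -> r = q %% n :> nat ->
  (r \in A) != (n <= q) -> r \notin rows q /\ rows q.+1 = r |: rows q.
Proof.
move=> q2 rq rA; case: (leqP n q) rA => nq rA.
  have qr : q = r + n by rewrite rq -{2}(subnK nq) modnDr modn_small; lia.
  move: rA; rewrite eqb_id => rA.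
  split; first by rewrite inE (negbTE rA) qr ltnn.
  apply/setP => i; rewrite !inE.
  case: (eqVneq i r) => [->|ir]; first by rewrite (negbTE rA) qr ltnS leqnn.
  have : nat_of_ord i != r by [].
  have := ltn_ord i; case: ifP => iA; lia.
have qr : q = r by rewrite rq modn_small.
have {}rA : r \in A by move: rA; case: (r \in A).
split; first by rewrite inE rA qr ltnn.
apply/setP => i; rewrite !inE.
case: (eqVneq i r) => [->|ir]; first by rewrite rA qr ltnS leqnn.
have : nat_of_ord i != r by [].
have := ltn_ord i; case: ifP => iA; lia.
Qed.

Lemma rows_early q : q <= n -> #|rows q| <= #|A|.
Proof.
move=> qn; apply/subset_leq_card/subsetP => i; rewrite inE.
by case: ifP => // _; rewrite ltnNge (leq_trans qn) ?leq_addl.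
Qed.

Lemma layer_final F : layer_ok (2 * n) F -> F setT = #|perfect_matchings E|.
Proof.
case=> _ _ H _; rewrite H ?subsetT //; last by lia.
rewrite -matchings_full; congr #|matchings _ _ _|; apply/setP => i.
by rewrite !inE; have := ltn_ord i; case: ifP => _; lia.
Qed.

Lemma layer_inactive q (r : 'I_n) F : q < 2 * n -> r = q %% n :> nat ->
  (r \in A) = (n <= q) -> layer_ok q F -> layer_ok q.+1 F.
Proof.
move=> q2 rq rA [H1 H2 H3 H4].
have rS := rowsS_inactive q2 rq rA; rewrite /layer_ok rS; split=> // qn.
  by apply: H2; apply: ltnW.
case: (leqP n q) qn => // [/H3 //|qn _] X _; apply: H2; exact: ltnW.
Qed.

Hypothesis SA : forall i j, j \in S -> (i, j) \in E -> i \in A.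
Hypothesis leBin : forall i, i <= #|A| -> 'C(n, i) <= B.
Hypothesis leSup : 2 ^ (n - #|S|) <= B.

Lemma layer_init : layer_ok 0 (fun X => X == set0).
Proof.
have r0 : rows 0 = set0 by apply/setP => i; rewrite !inE; case: ifP.
split; rewrite ?r0; try by move=> *; rewrite matchings0.
rewrite (leq_trans _ (leBin (leq0n _))) // bin0.
rewrite (eq_card (_ : _ =i [set set0])) ?cards1 // => X.
by rewrite !inE eqb0 negbK.
Qed.

(* Dropping loses nothing: a row outside A has no edge to S, so a set containing S
   is only reached from sets containing S. *)
Lemma layer_active q (r : 'I_n) F : q < 2 * n -> r = q %% n :> nat ->
  (r \in A) != (n <= q) -> layer_ok q F -> layer_ok q.+1 (next (n <= q) r F).
Proof.
move=> q2 rq rA [H1 H2 H3 H4].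
have [rR rS] := rowsS_active q2 rq rA.
have le X : next (n <= q) r F X <= #|matchings E (rows q.+1) X|.
  rewrite rS matchings_rec // /next big_mkcond [X in _ <= X]big_mkcond /=.
  apply: leq_sum => j _; case: (j \in X) => //=; case: (_ \in E) => //=.
  by case: ifP => _.
case: (leqP n q) rA le => nq rA le.
  move: rA; rewrite eqb_id => rA.
  split=> //; first by lia.
    move=> _ X SX; rewrite rS matchings_rec // /next /=.
    rewrite big_mkcond [RHS]big_mkcond; apply: eq_bigr => j _.
    case: (j \in X) => //=; case: (boolP (_ \in E)) => //= rjE.
    have sub : S \subset X :\ j.
      by rewrite subsetD1 SX; apply: contraNN rA => /SA; apply.
    by rewrite sub H3.
  (* A nonzero entry has a predecessor containing [S], hence contains [S] itself. *)
  apply: leq_trans leSup; apply: card_supersets => X; rewrite inE /next.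
  apply: contraNT => SX; rewrite big_pred0 // => j; apply/negbTE/negP.
  by case/and3P => _ _ /= sub; case/negP: SX; apply: subset_trans sub (subsetDl _ _).
have eqG X : next false r F X = #|matchings E (rows q.+1) X|.
  rewrite rS matchings_rec // /next; apply: eq_big => j; rewrite ?andbT //.
  by rewrite H2 // ltnW.
split=> //.
apply: leq_trans (leBin (rows_early nq)); apply: card_layer_bound => X.
by rewrite inE eqG => /matchings_card.
Qed.

End Layers.

(** * The program *)

(* Above the n^2 input cells, four arrays are interleaved: array [c] has its [x]-th
   entry in cell n^2 + 4x + c.  Array 0 is the table of counts indexed by the bit
   masks of column sets, array 1 the queue of masks, arrays 2 and 3 the indicators
   of S and of its neighbourhood. *)
Definition cell (c : nat) (e : expr) : expr :=
  Op Add (Op Mul (Reg 0) (Reg 0)) (Op Add (Op Mul (Cst 4) e) (Cst c)).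
Definition arr (c : nat) (e : expr) : expr := Mem (cell c e).
Definition entry (i j : expr) : expr := Mem (Op Add (Op Mul i (Reg 0)) j).
Definition incr (r : nat) (e : expr) : cmd := SetReg r (Op Add (Reg r) e).
Definition double (r : nat) : cmd := SetReg r (Op Mul (Cst 2) (Reg r)).

Arguments cell : simpl never.
Arguments arr : simpl never.
Arguments entry : simpl never.

(* Registers: 0 n, 1 |E|, 2 |S|, 3 column, 4 row, 5 degree, 6 step, 7 current row,
   8 phase, 9-10 bounds of the current layer in the queue, 11 end of the queue,
   12 position in the layer, 13 current mask, 14 power of two, 15 number of columns
   of S missed by the mask. *)
Definition p_deg : cmd :=
  Seq (SetReg 5 (Cst 0)) (For 4 (Reg 0) (incr 5 (entry (Reg 4) (Reg 3)))).

Definition p_count : cmd := For 3 (Reg 0) (Seq p_deg (incr 1 (Reg 5))).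

Definition p_mark : cmd :=
  Seq (SetMem (cell 2 (Reg 3)) (Cst 1))
 (Seq (incr 2 (Cst 1))
      (For 4 (Reg 0) (If (entry (Reg 4) (Reg 3)) (SetMem (cell 3 (Reg 4)) (Cst 1)) Skip))).

(* With truncated subtraction, the test says 2 deg(j) n <= 3 |E| and
   5 |E| (|S| + 1) <= n^2. *)
Definition p_select : cmd :=
  For 3 (Reg 0)
   (Seq p_deg
    (If (Op Mul
          (Op Sub (Op Add (Op Mul (Cst 3) (Reg 1)) (Cst 1))
                  (Op Mul (Op Mul (Cst 2) (Reg 5)) (Reg 0)))
          (Op Sub (Op Add (Op Mul (Reg 0) (Reg 0)) (Cst 1))
                  (Op Mul (Op Mul (Cst 5) (Reg 1)) (Op Add (Reg 2) (Cst 1)))))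
        p_mark Skip)).

Definition quo : expr := Op Div (Reg 13) (Reg 14).
(** One minus the parity of the quotient. The machine has no remainder operation, so the parity is q
    - 2 (q / 2). *)
Definition unset : expr :=
  Op Sub (Cst 1) (Op Sub quo (Op Mul (Cst 2) (Op Div quo (Cst 2)))).
Definition target : expr := Op Add (Reg 13) (Reg 14).

(** The phase bit in register 8 is a factor of each summand, so nothing is dropped in the first
    phase. *)
Definition p_dead : cmd :=
  Seq (SetReg 15 (Cst 0))
 (Seq (SetReg 14 (Cst 1))
      (For 3 (Reg 0)
        (Seq (incr 15 (Op Mul (Reg 8) (Op Mul (arr 2 (Reg 3)) unset))) (double 14)))).

(** A zero entry signals that the target is not queued yet, so the test has to precede the
    addition. *)
Definition p_push : cmd :=
  Seq (If (arr 0 target) Skip (Seq (SetMem (cell 1 (Reg 11)) target) (incr 11 (Cst 1))))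
      (SetMem (cell 0 target) (Op Add (arr 0 target) (arr 0 (Reg 13)))).

Definition p_expand : cmd :=
  Seq (SetReg 14 (Cst 1))
      (For 3 (Reg 0)
        (Seq (If (Op Mul unset (entry (Reg 7) (Reg 3))) p_push Skip) (double 14))).

Definition p_state : cmd :=
  Seq (SetReg 13 (arr 1 (Op Add (Reg 9) (Reg 12))))
 (Seq p_dead (If (Reg 15) Skip p_expand)).

(** Register 10 freezes the end of the current layer while pushes advance register 11. *)
Definition p_layer : cmd :=
  Seq (SetReg 10 (Reg 11))
 (Seq (For 12 (Op Sub (Reg 10) (Reg 9)) p_state) (SetReg 9 (Reg 10))).

(* Step q < 2n considers row q mod n; it is active when the row lies in the
   neighbourhood of S (q < n) or outside of it (q >= n). *)
Definition p_step : cmd :=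
  Seq (SetReg 8 (Op Div (Reg 6) (Reg 0)))
 (Seq (SetReg 7 (Op Sub (Reg 6) (Op Mul (Reg 8) (Reg 0))))
      (If (Op Add (Op Sub (arr 3 (Reg 7)) (Reg 8)) (Op Sub (Reg 8) (arr 3 (Reg 7))))
          p_layer Skip)).

Definition p_main : cmd :=
  Seq (SetMem (cell 0 (Cst 0)) (Cst 1))
 (Seq (SetReg 11 (Cst 1)) (For 6 (Op Mul (Cst 2) (Reg 0)) p_step)).

Definition p_out : cmd :=
  Seq (SetReg 14 (Cst 1))
 (Seq (For 3 (Reg 0) (double 14)) (SetReg 0 (arr 0 (Op Sub (Reg 14) (Cst 1))))).

Definition prog : cmd := Seq p_count (Seq p_select (Seq p_main p_out)).

(** * Correctness and step counts of the program *)

Definition fset (f : nat -> nat) (x v : nat) : nat -> nat :=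
  fun y => if y == x then v else f y.

Lemma psumS n (f : 'I_n -> nat) (k : 'I_n) :
  \sum_(i < n | i < k.+1) f i = \sum_(i < n | i < k) f i + f k.
Proof.
rewrite (bigD1 k) //= addnC; congr (_ + _); apply: eq_bigl => i.
by rewrite ltnS ltn_neqAle andbC.
Qed.

Lemma psum0 n (f : 'I_n -> nat) : \sum_(i < n | i < 0) f i = 0.
Proof. by rewrite big_pred0. Qed.

Lemma psum_full n (f : 'I_n -> nat) : \sum_(i < n | i < n) f i = \sum_i f i.
Proof. by apply: eq_bigl => i; rewrite ltn_ord. Qed.

Lemma eval_op s o e1 e2 : eval s (Op o e1 e2) = binop_eval o (eval s e1) (eval s e2).
Proof. by []. Qed.

Lemma eval_cst s k : eval s (Cst k) = k.
Proof. by []. Qed.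

Lemma eval_reg s r : eval s (Reg r) = s (inl r).
Proof. by []. Qed.

Section Program.

Variables (n : nat) (E : bigraph n).

(** Normal form for symbolic execution: [rs] lists the registers from 1 on, register 0 is fixed at
    [n], and the input cells are read-only. Interleaving modulo 4 makes each array a function on all
    of [nat], with no overlap conditions. *)
Definition St (rs : seq nat) (h qu mk ia : nat -> nat) : state := fun l =>
  match l with
  | inl r => nth 0 (n :: rs) r
  | inr a => if a < n * n then input E (inr a) else
      let y := a - n * n in
      match y %% 4 with
      | 0 => h (y %/ 4) | 1 => qu (y %/ 4) | 2 => mk (y %/ 4) | _ => ia (y %/ 4)
      end
  end.

Arguments St : simpl never.

Lemma St_reg rs h qu mk ia r : St rs h qu mk ia (inl r) = nth 0 (n :: rs) r.
Proof. by []. Qed.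

Lemma upd_reg rs h qu mk ia r v :
  upd (St rs h qu mk ia) (inl r.+1) v = St (set_nth 0 rs r v) h qu mk ia.
Proof.
apply/funext => -[r'|a]; last by [].
rewrite /upd /St.
rewrite (inj_eq (@inl_inj _ _)); case: r' => [|r'] //=.
by rewrite nth_set_nth /= eqSS.
Qed.

Lemma St_cell rs h qu mk ia c x : c < 4 ->
  St rs h qu mk ia (inr (n * n + (4 * x + c))) =
  match c with 0 => h x | 1 => qu x | 2 => mk x | _ => ia x end.
Proof.
move=> c4; rewrite /St ltnNge leq_addr /= addKn mulnC modnMDl divnMDl // modn_small //.
by rewrite divn_small // addn0.
Qed.

Lemma upd_cell rs h qu mk ia c x v : c < 4 ->
  upd (St rs h qu mk ia) (inr (n * n + (4 * x + c))) v =
  St rs (if c == 0 then fset h x v else h) (if c == 1 then fset qu x v else qu)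
     (if c == 2 then fset mk x v else mk) (if c == 3 then fset ia x v else ia).
Proof.
move=> c4; apply/funext => -[r|a]; rewrite /upd //.
rewrite (inj_eq (@inr_inj _ _)) /St.
case: (ltnP a (n * n)) => an; first by rewrite ltn_eqF // ltn_addr.
rewrite -{1}(subnKC an) eqn_add2l.
have -> : (a - n * n == 4 * x + c) = ((a - n * n) %% 4 == c) && ((a - n * n) %/ 4 == x).
  apply/eqP/andP => [->|[/eqP <- /eqP <-]].
    by rewrite mulnC modnMDl divnMDl // modn_small // divn_small // addn0 !eqxx.
  by rewrite mulnC -divn_eq.
have := ltn_pmod (a - n * n) (isT : 0 < 4).
move: (_ %% 4) (_ %/ 4) => m d m4.
by case: m m4 c4 => [|[|[|[|]]]] //; case: c => [|[|[|[|]]]] //= _ _; rewrite /fset; case: eqP.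
Qed.

Lemma eval_arr0 rs h qu mk ia e :
  eval (St rs h qu mk ia) (arr 0 e) = h (eval (St rs h qu mk ia) e).
Proof. exact: (@St_cell _ _ _ _ _ 0). Qed.

Lemma eval_arr1 rs h qu mk ia e :
  eval (St rs h qu mk ia) (arr 1 e) = qu (eval (St rs h qu mk ia) e).
Proof. exact: (@St_cell _ _ _ _ _ 1). Qed.

Lemma eval_arr2 rs h qu mk ia e :
  eval (St rs h qu mk ia) (arr 2 e) = mk (eval (St rs h qu mk ia) e).
Proof. exact: (@St_cell _ _ _ _ _ 2). Qed.

Lemma eval_arr3 rs h qu mk ia e :
  eval (St rs h qu mk ia) (arr 3 e) = ia (eval (St rs h qu mk ia) e).
Proof. exact: (@St_cell _ _ _ _ _ 3). Qed.

Lemma eval_cell rs h qu mk ia c e :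
  eval (St rs h qu mk ia) (cell c e) = n * n + (4 * eval (St rs h qu mk ia) e + c).
Proof. by []. Qed.

Lemma input_entry (i j : 'I_n) : input E (inr (i * n + j)) = ((i, j) \in E).
Proof.
rewrite /input; congr nat_of_bool; apply/existsP/idP => [[i' /existsP [j' /andP [/eqP eq ij]]]|ij].
  have n0 : 0 < n by apply: leq_ltn_trans (ltn_ord i).
  have -> : i = i'.
    by apply: val_inj; have := congr1 (divn^~ n) eq; rewrite /= !divnMDl // !divn_small ?addn0.
  have -> // : j = j'.
  by apply: val_inj; have := congr1 (modn^~ n) eq; rewrite /= !modnMDl !modn_small.
by exists i; apply/existsP; exists j; rewrite eqxx.
Qed.

Lemma eval_entry rs h qu mk ia e1 e2 (i j : 'I_n) :
  eval (St rs h qu mk ia) e1 = i -> eval (St rs h qu mk ia) e2 = j ->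
  eval (St rs h qu mk ia) (entry e1 e2) = ((i, j) \in E).
Proof.
rewrite /= => -> ->; rewrite -input_entry /St.
suff -> : i * n + j < n * n by [].
have := ltn_ord i; have := ltn_ord j; nia.
Qed.

Definition evE := (eval_cell, eval_arr0, eval_arr1, eval_arr2, eval_arr3, eval_op, eval_cst, eval_reg, St_reg).

Lemma St_input : input E = St (nseq 15 0) (fun=> 0) (fun=> 0) (fun=> 0) (fun=> 0).
Proof.
apply/funext => -[[|r]|a]; rewrite /St //=.
  by rewrite (@nth_nseq nat 0 15 0 r) if_same.
case: ltnP => // an; set rhs := (RHS); have -> : rhs = 0.
  by rewrite /rhs; case: (_ %% 4) => [|[|[|]]].
apply/eqP; rewrite eqb0; apply/existsP => -[i /existsP [j /andP [/eqP ea _]]].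
have := ltn_ord i; have := ltn_ord j; nia.
Qed.

Local Arguments eval : simpl never.

Lemma deg_le j : deg E j <= n.
Proof.
rewrite deg_sum; apply: (@leq_trans (\sum_(i < n) 1)).
  by apply: leq_sum => i _; apply: leq_b1.
by rewrite sum_nat_const card_ord muln1.
Qed.

Lemma card_edges_le : #|E| <= n * n.
Proof. by rewrite (leq_trans (max_card _)) // card_prod card_ord. Qed.

Variables L W : nat.
Hypothesis L_gt0 : 0 < L.
Hypothesis n_gt0 : 0 < n.
(** One word length for everything stored: counts up to 2^(n^2), positions in a queue that is never
    reclaimed (2n layers of at most 2^n sets after the initial one), masks and small numbers. *)
Hypothesis HV : 2 ^ (n * n) + (2 * n + 1) * 2 ^ n + n * n + 2 * n + 10 < 2 ^ L.

Local Notation run := (run L W).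

Lemma val_small v : v <= n * n + 2 * n + 10 -> v < 2 ^ L.
Proof. by move=> hv; apply: leq_ltn_trans HV; move: hv; move: (2 ^ (n * n)) ((2 * n + 1) * 2 ^ n) => a b; lia. Qed.

Lemma val_index v : v <= (2 * n + 1) * 2 ^ n -> v < 2 ^ L.
Proof.
by move=> hv; apply: leq_ltn_trans HV; move: hv; move: (2 ^ (n * n)) ((2 * n + 1) * 2 ^ n) => a b; lia.
Qed.

Lemma val_mask v : v <= 2 ^ n -> v < 2 ^ L.
Proof. by move=> hv; apply: val_index; rewrite (leq_trans hv) // leq_pmull // addn1. Qed.

Lemma val_count v : v <= 2 ^ (n * n) -> v < 2 ^ L.
Proof. by move=> hv; apply: leq_ltn_trans HV; move: hv; move: (2 ^ (n * n)) ((2 * n + 1) * 2 ^ n) => a b; lia. Qed.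

Ltac small := apply: val_small; lia.
Ltac ev := rewrite ?evE /=.

Lemma run_deg e k (j : 'I_n) i d rest h qu mk ia :
  run p_deg (St [:: e, k, val j, i, d & rest] h qu mk ia) (1 + (n * 3).+2)
    (fun s => exists i', s = St [:: e, k, val j, i', deg E j & rest] h qu mk ia).
Proof.
apply: run_seq; apply: (run_set L_gt0); rewrite ?upd_reg ?evE /=; first by small.
have lp := @run_for L W L_gt0 (fun m s => s =
  St [:: e, k, val j, m, \sum_(i < n | i < m) ((i, j) \in E) & rest] h qu mk ia) n 1.
apply: run_weaken; [apply: lp| by []| ].
- small.
- by move=> m s _ ->; rewrite !evE.
- move=> m s mn ->; pose i0 := Ordinal mn.
  have ee := @eval_entry [:: e, k, val j, m, \sum_(i < n | i < m) ((i, j) \in E) & rest] h qu mk ia (Reg 4) (Reg 3) i0 j erefl erefl.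
  apply: (run_set L_gt0).
    rewrite evE ee !evE /=; apply: val_small.
    have h1 : \sum_(i < n | i < m) ((i, j) \in E) <= deg E j.
      by rewrite deg_sum [X in _ <= X](bigID (fun i : 'I_n => i < m)) /= leq_addr.
    by apply: leq_trans (leq_add (leq_trans h1 (deg_le j)) (leq_b1 _)) _; lia.
  rewrite evE ee !evE !upd_reg /=; split=> //.
  by rewrite (psumS _ i0).
- by rewrite upd_reg /= psum0.
- by move=> s _ ->; exists n; rewrite psum_full -deg_sum.
Qed.

Lemma run_count k j i d rest h qu mk ia :
  run p_count (St [:: 0, k, j, i, d & rest] h qu mk ia)
    (n * (1 + (n * 3).+2 + 1).+2).+2
    (fun s => exists j i d, s = St [:: #|E|, k, j, i, d & rest] h qu mk ia).
Proof.
have lp := @run_for L W L_gt0 (fun m s => exists i d, s =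
  St [:: \sum_(j < n | j < m) deg E j, k, m, i, d & rest] h qu mk ia) n (1 + (n * 3).+2 + 1).
apply: run_weaken; [apply: lp| by []| ].
- small.
- by move=> m s _ [i1 [d1 ->]]; rewrite !evE.
- move=> m s mn [i1 [d1 ->]]; pose j0 := Ordinal mn.
  apply: run_seq; apply: run_weaken.
  + exact (@run_deg _ _ j0 _ _ _ _ _ _ _).
  + by [].
  move=> s1 _ [i2 ->]; apply: (run_set L_gt0); rewrite !evE /=.
    rewrite -(psumS _ j0); apply: val_small.
    have : \sum_(i0 < n | i0 < j0.+1) deg E i0 <= #|E|.
      by rewrite -sum_deg [X in _ <= X](bigID (fun i : 'I_n => i < j0.+1)) /= leq_addr.
    have := card_edges_le; lia.
  rewrite !upd_reg /=; split=> //.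
  by exists i2, (deg E j0); rewrite -(psumS _ j0).
- by rewrite upd_reg /=; exists i, d; rewrite psum0.
- by move=> s _ [i1 [d1 ->]]; exists n, i1, d1; rewrite psum_full sum_deg.
Qed.

Lemma run_mark e k (j : 'I_n) i d rest h qu mk ia : k < n ->
  run p_mark (St [:: e, k, val j, i, d & rest] h qu mk ia)
    (1 + (1 + (n * 4).+2))
    (fun s => exists i ia', s =
       St [:: e, k.+1, val j, i, d & rest] h qu (fset mk j 1) ia' /\
       forall i : 'I_n, ia' i = if (i, j) \in E then 1 else ia i).
Proof.
move=> kn; apply: run_seq; apply: (run_setmem L_gt0); rewrite ?evE /=; first small.
rewrite (@upd_cell _ _ _ _ _ 2 _ _ isT) /=; apply: run_seq; apply: (run_set L_gt0); rewrite !evE /=.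
  by small.
rewrite upd_reg /= addn1.
have lp := @run_for L W L_gt0 (fun m s => exists ia', s =
  St [:: e, k.+1, val j, m, d & rest] h qu (fset mk j 1) ia' /\
  forall i : 'I_n, ia' i = if (i < m) && ((i, j) \in E) then 1 else ia i) n 2.
apply: run_weaken; [apply: lp| by []| ].
- small.
- by move=> m s _ [ia' [-> _]]; rewrite !evE.
- move=> m s mn [ia' [-> Hia]]; pose i0 := Ordinal mn.
  apply: (run_if L_gt0); rewrite (@eval_entry _ _ _ _ _ _ _ i0 j) //.
  have same (i' : 'I_n) : i' < m.+1 = (i' == i0) || (i' < m).
    by rewrite ltnS leq_eqVlt -(inj_eq val_inj).
  case: (boolP ((i0, j) \in E)) => ij /=.
    apply: (run_setmem L_gt0); rewrite ?evE /=; first by small.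
    rewrite (@upd_cell _ _ _ _ _ 3 _ _ isT) /= St_reg upd_reg /=; split=> //.
    eexists; split; first reflexivity.
    move=> i'; rewrite same /fset -(inj_eq val_inj) /= Hia.
    case: eqVneq => //= im.
    by rewrite (_ : i' = i0) ?ij //; apply: val_inj.
  apply: (run_skip L_gt0); rewrite St_reg upd_reg /=; split=> //.
  eexists; split; first reflexivity.
  move=> i'; rewrite same Hia -(inj_eq val_inj) /=.
  case: eqVneq => //= im.
  by rewrite (_ : i' = i0) ?(negbTE ij) ?andbF //; apply: val_inj.
- rewrite upd_reg /=; eexists; split; first reflexivity.
  by move=> i'.
- move=> s _ [ia' [-> Hia]]; exists n, ia'; split=> // i'.
  by rewrite Hia ltn_ord.
Qed.

(** Invariant of the greedy choice. If room for one more column is left now, room was left at every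
    earlier column, so each eligible one was taken. *)
Definition selected_upto m (S : {set 'I_n}) :=
  [/\ forall j, j \in S -> 2 * deg E j * n <= 3 * #|E|,
      5 * #|E| * #|S| <= n * n,
      forall j, j \in S -> j < m
    & 5 * #|E| * #|S|.+1 <= n * n ->
      forall j : 'I_n, j < m -> 2 * deg E j * n <= 3 * #|E| -> j \in S].

Lemma run_select j i d rest h qu :
  run p_select (St [:: #|E|, 0, j, i, d & rest] h qu (fun=> 0) (fun=> 0))
    (n * (1 + (n * 3).+2 + (1 + (1 + (n * 4).+2)).+1).+2).+2
    (fun s => exists (S : {set 'I_n}) j i d mk ia,
       [/\ s = St [:: #|E|, #|S|, j, i, d & rest] h qu mk ia,
           selected_upto n S,
           forall j : 'I_n, mk j = (j \in S)
         & forall i : 'I_n, ia i = (i \in nbr E S)]).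
Proof.
have lp := @run_for L W L_gt0 (fun m s => exists (S : {set 'I_n}) i d mk ia,
       [/\ s = St [:: #|E|, #|S|, m, i, d & rest] h qu mk ia,
           selected_upto m S,
           forall j : 'I_n, mk j = (j \in S)
         & forall i : 'I_n, ia i = (i \in nbr E S)]) n
  (1 + (n * 3).+2 + (1 + (1 + (n * 4).+2)).+1).
apply: run_weaken; [apply: lp| by []| ].
- small.
- by move=> m s _ [S [i1 [d1 [mk [ia [-> _ _ _]]]]]]; rewrite !evE.
- move=> m s mn [S [i1 [d1 [mk [ia [-> [S1 S2 S3 S4] Hmk Hia]]]]]]; pose j0 := Ordinal mn.
  apply: run_seq; apply: run_weaken.
  + exact (@run_deg _ _ j0 _ _ _ _ _ _ _).
  + by [].
  move=> s1 _ [i2 ->]; apply: (run_if L_gt0); rewrite !evE /=.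
  have j0S : j0 \notin S by apply/negP => /S3; rewrite ltnn.
  have cS : #|j0 |: S| = #|S|.+1 by rewrite cardsU1 j0S.
  have Sn : #|S| < n by rewrite -cS -[leqRHS]card_ord max_card.
  rewrite muln_eq0 negb_or !subn_eq0 -!ltnNge !addn1 !ltnS.
  case: ifPn => [/andP [good room]|H].
    apply: run_weaken; [exact (@run_mark _ _ j0 _ _ _ _ _ _ _ Sn)|by []|].
    move=> s2 _ [i3 [ia' [-> Hia']]]; rewrite St_reg upd_reg /=; split=> //.
    exists (j0 |: S), i3, (deg E j0), (fset mk m 1), ia'; split.
    + by rewrite cS.
    + rewrite /selected_upto cS; split.
      * by move=> j'; rewrite in_setU1 => /orP [/eqP ->|/S1].
      * by [].
      * by move=> j'; rewrite in_setU1 => /orP [/eqP ->|/S3 /ltnW //]; rewrite ltnS.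
      * move=> room' j'; rewrite ltnS leq_eqVlt in_setU1 -(inj_eq val_inj) /=.
        by case: eqVneq => //= _ jm gd; apply: S4.
    + by move=> j'; rewrite /fset in_setU1 -(inj_eq val_inj) Hmk /=; case: eqVneq.
    + move=> i'; rewrite Hia' Hia !inE.
      case: (boolP ((i', j0) \in E)) => ij.
        suff -> : [exists j in j0 |: S, (i', j) \in E] by [].
        by apply/exists_inP; exists j0; rewrite ?setU11.
      congr nat_of_bool; apply/exists_inP/exists_inP => -[j' j'S ij'].
        by exists j' => //; rewrite in_setU1 j'S orbT.
      move: j'S; rewrite in_setU1 => /orP [/eqP ej|j'S]; last by exists j'.
      by rewrite ej (negbTE ij) in ij'.
  apply: run_weaken; [apply: (run_skip L_gt0); exact: erefl|by []|].
  move=> s2 _ <-; rewrite St_reg upd_reg /=; split=> //.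
  exists S, i2, (deg E j0), mk, ia; split=> //; split=> // [j' /S3 /ltnW //|].
  move=> room j'; rewrite ltnS leq_eqVlt => /orP [/eqP ej gd|jm gd]; last exact: S4.
  have ej' : j' = j0 by apply: val_inj.
  by case/negP: H; rewrite room andbT -ej'.
- rewrite upd_reg /=; exists set0, i, d, (fun=> 0), (fun=> 0); split.
  + by rewrite cards0.
  + by split; rewrite ?cards0 ?muln0 // => j'; rewrite inE.
  + by move=> j'; rewrite inE.
  + move=> i'; rewrite inE; case: existsP => // -[j']; by rewrite inE.
- move=> s _ [S [i1 [d1 [mk [ia [-> H1 H2 H3]]]]]].
  by exists S, n, i1, d1, mk, ia.
Qed.

Lemma unset_val x : 1 - (x - 2 * (x %/ 2)) = ~~ odd x.
Proof. by rewrite {1}(divn_eq x 2) mulnC addKn modn2; case: (odd x). Qed.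

Lemma size_uniq_sets (ls : seq {set 'I_n}) : uniq ls -> size ls <= 2 ^ n.
Proof.
move=> /card_uniqP <-; rewrite (leq_trans (max_card _)) //.
by rewrite -cardsT -powersetT card_powerset cardsT card_ord.
Qed.

Lemma run_dead (S Y : {set 'I_n}) (late : bool) e c j i d q r lo mid hi x p dd
    (h qu mk ia : nat -> nat) :
  (forall j : 'I_n, mk j = (j \in S)) ->
  run p_dead
    (St [:: e; c; j; i; d; q; r; nat_of_bool late; lo; mid; hi; x; mask Y; p; dd] h qu mk ia)
    (1 + (1 + (n * 4).+2))
    (fun s => exists j p dd, s =
       St [:: e; c; j; i; d; q; r; nat_of_bool late; lo; mid; hi; x; mask Y; p; dd] h qu mk ia
       /\ (dd != 0) = ~~ alive S late Y).
Proof.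
move=> Hmk; apply: run_seq; apply: (run_set L_gt0); rewrite ?evE /=; first by small.
rewrite upd_reg /=; apply: run_seq; apply: (run_set L_gt0); rewrite ?evE /=; first by small.
rewrite upd_reg /=.
pose f (j : 'I_n) := late * ((j \in S) * (j \notin Y)).
have lp := @run_for L W L_gt0 (fun m s => s = St [:: e; c; m; i; d; q; r;
  nat_of_bool late; lo; mid; hi; x; mask Y; 2 ^ m; \sum_(j < n | j < m) f j] h qu mk ia) n (1 + 1).
apply: run_weaken; [apply: lp| by []| ].
- small.
- by move=> m s _ ->; rewrite !evE.
- move=> m s mn ->; pose j0 := Ordinal mn.
  apply: run_seq; apply: (run_set L_gt0); rewrite !evE /= unset_val (mask_bit Y j0) (Hmk j0).
    rewrite -/(f j0) -(psumS _ j0); apply: val_small.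
    have h1 : \sum_(i0 < n | i0 < j0.+1) f i0 <= n.
      apply: (@leq_trans (\sum_(i0 < n) 1)); last by rewrite sum_nat_const card_ord muln1.
      rewrite big_mkcond; apply: leq_sum => j' _; rewrite /f.
      by case: ifP => // _; case: (late); case: (_ \in S); case: (_ \in Y).
    apply: leq_trans h1 _; lia.
  rewrite -/(f j0) -(psumS _ j0) upd_reg /=; apply: (run_set L_gt0); rewrite !evE /=.
    by apply: val_mask; rewrite -expnS leq_exp2l.
  by rewrite upd_reg St_reg /= upd_reg /= -expnS.
- by rewrite upd_reg /= psum0.
- move=> s _ ->; do 3 eexists; split; first reflexivity.
  rewrite psum_full sum_nat_eq0 negb_forall /alive negb_imply.
  apply/existsP/andP => [[j1]|[lt /subsetPn [j1 jS jY]]].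
    rewrite /f; case: (late) => //=; case: (boolP (_ \in S)) => //= jS.
    case: (boolP (_ \in Y)) => //= jY _; split=> //; apply/subsetPn; by exists j1.
  by exists j1; rewrite /f lt jS jY.
Qed.

(* Memory while a layer of sets of size i is expanded: [ls] is the current layer with
   counts F, and [ls'] the part of the next layer found so far, with counts P. *)
Definition frontier (i : nat) (F P : {set 'I_n} -> nat) (lo mid : nat)
    (ls ls' : seq {set 'I_n}) (h qu : nat -> nat) :=
  [/\ [/\ forall X : {set 'I_n}, #|X| = i -> h (mask X) = F X,
          forall X : {set 'I_n}, #|X| = i.+1 -> h (mask X) = P X
        & forall X : {set 'I_n}, i.+1 < #|X| -> h (mask X) = 0],
      forall x, x < size ls -> qu (lo + x) = mask (nth set0 ls x),
      forall x, x < size ls' -> qu (mid + x) = mask (nth set0 ls' x),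
      uniq ls'
    & forall X, (X \in ls') = (P X != 0)].

Lemma run_push i F P lo mid ls ls' (j : 'I_n) (Y : {set 'I_n})
    e c i0 d q r ps x dd (h qu mk ia : nat -> nat) :
  frontier i F P lo mid ls ls' h qu ->
  lo + size ls = mid -> #|Y| = i -> j \notin Y -> F Y != 0 ->
  P (j |: Y) + F Y <= 2 ^ (n * n) -> mid + 2 ^ n <= (2 * n + 1) * 2 ^ n ->
  run p_push
    (St [:: e; c; val j; i0; d; q; r; ps; lo; mid; mid + size ls'; x; mask Y; 2 ^ j; dd]
        h qu mk ia)
    4
    (fun s => exists ls' h qu, s =
       St [:: e; c; val j; i0; d; q; r; ps; lo; mid; mid + size ls'; x; mask Y; 2 ^ j; dd]
         h qu mk ia /\
       frontier i F (fun X => P X + (X == j |: Y) * F Y) lo mid ls ls' h qu).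
Proof.
move=> [[hF hP h0] ql ql' uls' mls'] lmid cY jY FY bP bmid.
have cX : #|j |: Y| = i.+1 by rewrite cardsU1 jY cY.
have tgt : mask Y + 2 ^ j = mask (j |: Y) by rewrite maskU1.
apply: (@run_seq L W 3 1).
(* Between the two commands the queue already matches the new counts while the table still holds
   [P]. *)
apply: (@run_weaken _ _ _ _ 3 _ (fun s => exists ls'' qu', [/\ s =
       St [:: e; c; val j; i0; d; q; r; ps; lo; mid; mid + size ls''; x; mask Y; 2 ^ j; dd]
         h qu' mk ia,
   (forall x, x < size ls -> qu' (lo + x) = mask (nth set0 ls x)) /\
   (forall x, x < size ls'' -> qu' (mid + x) = mask (nth set0 ls'' x)), uniq ls'' &
    forall X, (X \in ls'') = (P X + (X == j |: Y) * F Y != 0)])) => //.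
  apply: (run_if L_gt0); rewrite !evE /= tgt hP //.
  case: ifPn => PX.
    apply: run_weaken; [apply: (run_skip L_gt0); exact: erefl|by []|].
    move=> s _ <-; exists ls', qu; split=> //.
    move=> X; rewrite mls' addn_eq0; case: (X =P _) => [->|_] /=; last by rewrite mul0n andbT.
    by rewrite (negbTE PX).
  have jYls : j |: Y \notin ls' by rewrite mls'.
  apply: (@run_seq L W 1 1); apply: (run_setmem L_gt0); rewrite !evE /=.
    by rewrite tgt; apply/val_mask/ltnW/mask_lt.
  rewrite (@upd_cell _ _ _ _ _ 1 _ _ isT) /=; apply: (run_set L_gt0); rewrite !evE /=.
    (* The extended list is still duplicate-free, so it has at most 2^n sets. *)
    apply: val_index; apply: leq_trans bmid; rewrite -addnA leq_add2l addn1.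
    have /size_uniq_sets : uniq (rcons ls' (j |: Y)) by rewrite rcons_uniq jYls.
    by rewrite size_rcons.
  rewrite upd_reg /= tgt; exists (rcons ls' (j |: Y)), (fset qu (mid + size ls') (mask (j |: Y))).
  split.
  + by rewrite size_rcons addn1 addnS.
  + split=> y; first by move=> yl; rewrite /fset ltn_eqF ?ql //; lia.
    rewrite size_rcons nth_rcons /fset eqn_add2l ltnS leq_eqVlt.
    by case: eqP => [->|_] /=; rewrite ?ltnn // => yl; rewrite yl ql'.
  + by rewrite rcons_uniq jYls.
  + move=> X; rewrite mem_rcons in_cons mls' addn_eq0 negb_and orbC.
    by case: (X =P _) => [_|_] /=; rewrite ?mul1n ?FY // ?orbF.
move=> s _ [ls'' [qu' [-> [q1 q2] uls'' mls'']]].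
apply: (run_setmem L_gt0); rewrite !evE /= tgt hP // hF //; first exact: val_count.
exists ls'', (fset h (mask (j |: Y)) (P (j |: Y) + F Y)), qu'; split.
  by rewrite (@upd_cell _ _ _ _ _ 0 _ _ isT).
(* Masks are injective, so the write affects no other set. *)
have hne X : X != j |: Y -> fset h (mask (j |: Y)) (P (j |: Y) + F Y) (mask X) = h (mask X).
  by rewrite /fset (inj_eq (@mask_inj n)) => /negbTE ->.
split=> //; split=> X cX'.
- by rewrite hne ?hF //; apply: contra_eq_neq cX' => ->; rewrite cX; lia.
- case: eqVneq => [->|ne]; last by rewrite mul0n addn0 hne ?hP.
  by rewrite /fset eqxx mul1n.
- rewrite hne ?h0 //; apply: contraTneq cX' => ->; by rewrite cX ltnn.
Qed.

Definition expand_cost := 1 + (n * (5 + 1).+2).+2.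
Definition state_cost := 1 + (1 + (1 + (n * 4).+2) + expand_cost.+1).

Lemma run_expand (S : {set 'I_n}) (late : bool) (r : 'I_n) i F P lo mid ls ls'
    (Y : {set 'I_n}) e c j i0 d q ps x p dd (h qu mk ia : nat -> nat) :
  frontier i F P lo mid ls ls' h qu ->
  lo + size ls = mid -> #|Y| = i -> F Y != 0 -> alive S late Y ->
  (forall k X, P X + contrib E S late r F Y k X <= 2 ^ (n * n)) ->
  mid + 2 ^ n <= (2 * n + 1) * 2 ^ n ->
  run p_expand
    (St [:: e; c; j; i0; d; q; val r; ps; lo; mid; mid + size ls'; x; mask Y; p; dd] h qu mk ia)
    expand_cost
    (fun s => exists j p ls' h qu, s =
       St [:: e; c; j; i0; d; q; val r; ps; lo; mid; mid + size ls'; x; mask Y; p; dd]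
         h qu mk ia /\
       frontier i F (fun X => P X + contrib E S late r F Y n X) lo mid ls ls' h qu).
Proof.
move=> fr lmid cY FY al bP bmid.
apply: run_seq; apply: (run_set L_gt0); rewrite ?evE /=; first by small.
rewrite upd_reg /=.
have lp := @run_for L W L_gt0 (fun m s => exists ls' h qu, s =
  St [:: e; c; m; i0; d; q; val r; ps; lo; mid; mid + size ls'; x; mask Y; 2 ^ m; dd] h qu mk ia
  /\ frontier i F (fun X => P X + contrib E S late r F Y m X) lo mid ls ls' h qu) n (5 + 1).
apply: run_weaken; [apply: lp| by []| ].
- small.
- by move=> m s _ [ls1 [h1 [qu1 [-> _]]]]; rewrite !evE.
- move=> m s mn [ls1 [h1 [qu1 [-> fr1]]]]; pose j0 := Ordinal mn.
  apply: run_seq.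
  apply: (@run_weaken _ _ _ _ 5 _ (fun s => exists ls' h qu, s =
    St [:: e; c; m; i0; d; q; val r; ps; lo; mid; mid + size ls'; x; mask Y; 2 ^ m; dd] h qu mk ia
    /\ frontier i F (fun X => P X + contrib E S late r F Y m.+1 X) lo mid ls ls' h qu)) => //.
    apply: (run_if L_gt0); rewrite eval_op (@eval_entry _ _ _ _ _ _ _ r j0) //.
    rewrite !evE /= unset_val (mask_bit Y j0) mulnb.
    case: ifPn; rewrite eqb0 negbK => cond.
      have /andP [jY rj] := cond.
      have eqP1 : (fun X => P X + contrib E S late r F Y m.+1 X) =
          (fun X => P X + contrib E S late r F Y m X + (X == j0 |: Y) * F Y).
        by apply/funext => X; rewrite (@contribS n E S late r F Y j0) al jY rj mul1n addnA.
      rewrite eqP1; apply: (@run_push i F _ lo mid ls ls1 j0) => //.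
      have := bP m.+1 (j0 |: Y); rewrite (@contribS n E S late r F Y j0) al jY rj mul1n eqxx mul1n.
      by rewrite addnA.
    apply: run_weaken; [apply: (run_skip L_gt0); exact: erefl|by []|].
    move=> s1 _ <-; exists ls1, h1, qu1; split=> //.
    suff -> : (fun X => P X + contrib E S late r F Y m.+1 X) =
          (fun X => P X + contrib E S late r F Y m X) by [].
    by apply/funext => X; rewrite (@contribS n E S late r F Y j0) al (negbTE cond) mul0n addn0.
  move=> s1 _ [ls2 [h2 [qu2 [-> fr2]]]].
  apply: (run_set L_gt0); rewrite !evE /=.
    by apply: val_mask; rewrite -expnS leq_exp2l.
  rewrite upd_reg St_reg /= upd_reg /= -expnS; split=> //.
  by exists ls2, h2, qu2.
- rewrite upd_reg /=; exists ls', h, qu; split=> //.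
  suff -> : (fun X => P X + contrib E S late r F Y 0 X) = P by [].
  by apply/funext => X; rewrite contrib0 addn0.
- by move=> s _ [ls1 [h1 [qu1 [-> fr1]]]]; exists n, (2 ^ n), ls1, h1, qu1.
Qed.

Lemma run_state (S : {set 'I_n}) (late : bool) (r : 'I_n) i F lo mid ls ls'
    e c j i0 d q k T p dd (h qu mk ia : nat -> nat) :
  (forall j : 'I_n, mk j = (j \in S)) ->
  uniq ls -> (forall X, (X \in ls) = (F X != 0)) ->
  (forall X : {set 'I_n}, F X != 0 -> #|X| = i) ->
  (forall X, next E S late r F X <= 2 ^ (n * n)) ->
  lo + size ls = mid -> mid + 2 ^ n <= (2 * n + 1) * 2 ^ n -> k < size ls ->
  frontier i F (fun X => \sum_(Y <- take k ls) contrib E S late r F Y n X) lo mid ls ls' h qu ->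
  run p_state
    (St [:: e; c; j; i0; d; q; val r; nat_of_bool late; lo; mid; mid + size ls'; k; T; p; dd]
        h qu mk ia)
    state_cost
    (fun s => exists j T p dd ls' h qu, s =
       St [:: e; c; j; i0; d; q; val r; nat_of_bool late; lo; mid; mid + size ls'; k; T; p; dd]
         h qu mk ia /\
       frontier i F (fun X => \sum_(Y <- take k.+1 ls) contrib E S late r F Y n X)
         lo mid ls ls' h qu).
Proof.
move=> Hmk uls mls Fi bnext lmid bmid kls fr.
have [_ ql _ _ _] := fr; set Y := nth set0 ls k.
have FY : F Y != 0 by rewrite -mls mem_nth.
have eqS : (fun X => \sum_(Y <- take k.+1 ls) contrib E S late r F Y n X) =
   (fun X => \sum_(Y <- take k ls) contrib E S late r F Y n X + contrib E S late r F Y n X).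
  by apply/funext => X; rewrite (take_nth set0) // -cats1 big_cat big_seq1.
rewrite eqS; apply: run_seq; apply: (run_set L_gt0); rewrite !evE /= (ql _ kls).
  by apply/val_mask/ltnW/mask_lt.
rewrite upd_reg /=; apply: run_seq; apply: run_weaken.
- exact (@run_dead S Y late _ _ _ _ _ _ _ _ _ _ _ _ _ _ _ _ _ Hmk).
- by [].
move=> s1 _ [j1 [p1 [dd1 [-> dead]]]].
apply: (run_if L_gt0); rewrite !evE /= dead; case: ifPn => al.
  apply: run_weaken; [apply: (run_skip L_gt0); exact: erefl|by []|].
  move=> s2 _ <-; do 7 eexists; split; first reflexivity.
  suff -> : (fun X => \sum_(Y <- take k ls) contrib E S late r F Y n X + contrib E S late r F Y n X)
    = (fun X => \sum_(Y <- take k ls) contrib E S late r F Y n X) by [].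
  by apply/funext => X; rewrite {2}/contrib (negbTE al) addn0.
rewrite negbK in al.
apply: run_weaken.
- apply: (run_expand fr lmid (Fi _ FY) FY al _ bmid) => k' X.
  by apply: leq_trans (bnext X); apply: leq_partial.
- by [].
- move=> s2 _ [j2 [p2 [ls2 [h2 [qu2 [-> fr2]]]]]].
  by do 7 eexists; split; first reflexivity.
Qed.

(** One table serves all layers, since sets of different sizes have different masks. Entries of
    smaller sets are stale and left unconstrained; those of larger sets are still zero, ready for
    accumulation. *)
Definition table (i : nat) (F : {set 'I_n} -> nat) (lo : nat) (ls : seq {set 'I_n})
    (h qu : nat -> nat) :=
  [/\ forall X : {set 'I_n}, #|X| = i -> h (mask X) = F X,
      forall X : {set 'I_n}, i < #|X| -> h (mask X) = 0,
      forall x, x < size ls -> qu (lo + x) = mask (nth set0 ls x),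
      uniq ls
    & forall X, (X \in ls) = (F X != 0)].

Lemma run_layer (S : {set 'I_n}) (late : bool) (r : 'I_n) i F lo mid ls B
    e c j i0 d q k T p dd (h qu mk ia : nat -> nat) :
  (forall j : 'I_n, mk j = (j \in S)) ->
  (forall X : {set 'I_n}, F X != 0 -> #|X| = i) ->
  (forall X, next E S late r F X <= 2 ^ (n * n)) ->
  lo + size ls + 2 ^ n <= (2 * n + 1) * 2 ^ n -> size ls <= B ->
  table i F lo ls h qu ->
  run p_layer
    (St [:: e; c; j; i0; d; q; val r; nat_of_bool late; lo; mid; lo + size ls; k; T; p; dd]
        h qu mk ia)
    (1 + ((B * state_cost.+2).+2 + 1))
    (fun s => exists j mid k T p dd ls' h qu, s =
       St [:: e; c; j; i0; d; q; val r; nat_of_bool late; lo + size ls; mid;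
              lo + size ls + size ls'; k; T; p; dd] h qu mk ia /\
       table i.+1 (next E S late r F) (lo + size ls) ls' h qu).
Proof.
move=> Hmk Fi bnext bmid lsB [hF h0 ql uls mls]; set hi := lo + size ls.
apply: run_seq; apply: (run_set L_gt0); rewrite !evE /=.
  by apply: val_index; apply: leq_trans bmid; rewrite leq_addr.
rewrite upd_reg /=; apply: run_seq.
have lp := @run_for L W L_gt0 (fun m s => exists j T p dd ls' h qu, s =
  St [:: e; c; j; i0; d; q; val r; nat_of_bool late; lo; hi; hi + size ls'; m; T; p; dd]
     h qu mk ia /\
  frontier i F (fun X => \sum_(Y <- take m ls) contrib E S late r F Y n X) lo hi ls ls' h qu)
  (size ls) state_cost.
apply: run_weaken; [apply: lp| | ].
- by apply: val_mask; apply: size_uniq_sets.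
- by move=> m s _ [j1 [T1 [p1 [dd1 [ls1 [h1 [qu1 [-> _]]]]]]]]; rewrite !evE /= addKn.
- move=> m s mls' [j1 [T1 [p1 [dd1 [ls1 [h1 [qu1 [-> fr1]]]]]]]].
  apply: run_weaken.
  + apply: (@run_state S late r i F lo hi ls ls1) => //.
  + by [].
  + move=> s2 _ [j2 [T2 [p2 [dd2 [ls2 [h2 [qu2 [-> fr2]]]]]]]].
    rewrite St_reg upd_reg /=; split=> //.
    by exists j2, T2, p2, dd2, ls2, h2, qu2.
- rewrite upd_reg /=; exists j, T, p, dd, [::], h, qu; split; first by rewrite addn0.
  split=> // [|X].
    split=> X cX; first exact: hF.
      by rewrite take0 big_nil h0 // cX.
    by rewrite h0 //; apply: ltnW.
  by rewrite take0 big_nil.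
- by rewrite !ltnS leq_mul.
move=> s _ [j1 [T1 [p1 [dd1 [ls1 [h1 [qu1 [-> fr1]]]]]]]].
apply: (run_set L_gt0); rewrite !evE /=.
  by apply: val_index; apply: leq_trans bmid; rewrite leq_addr.
rewrite upd_reg /=; do 9 eexists; split; first reflexivity.
have eqN : (fun X => \sum_(Y <- take (size ls) ls) contrib E S late r F Y n X) =
           next E S late r F.
  by apply/funext => X; rewrite take_size next_sum.
rewrite eqN in fr1; case: fr1 => [[f1 f2 f3] f4 f5 f6 f7].
by split.
Qed.

(** * The two sweeps over the rows *)

Section MainLoop.

Variables (S : {set 'I_n}) (B : nat).
Let A := nbr E S.
Hypothesis leBin : forall i, i <= #|A| -> 'C(n, i) <= B.
Hypothesis leSup : 2 ^ (n - #|S|) <= B.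

Let SA i j : j \in S -> (i, j) \in E -> i \in A.
Proof. by move=> jS ij; rewrite inE; apply/exists_inP; exists j. Qed.

Variables (e c i0 d : nat) (mk ia : nat -> nat).
Hypothesis Hmk : forall j : 'I_n, mk j = (j \in S).
Hypothesis Hia : forall i : 'I_n, ia i = (i \in A).

(** The sets of the layer have as many elements as rows were handled, not as many as steps were
    made, since inactive steps leave the layer as it is. *)
Definition main_inv (q : nat) (s : state) :=
  exists F ls lo j r ps mid k T p dd h qu,
    [/\ s = St [:: e; c; j; i0; d; q; r; ps; lo; mid; lo + size ls; k; T; p; dd] h qu mk ia,
        layer_ok E S A B q F, table #|rows A q| F lo ls h qu
      & lo + size ls <= 1 + q * 2 ^ n].

Definition step_cost := 1 + (1 + (1 + ((B * state_cost.+2).+2 + 1)).+1).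

Lemma run_step q s : q < 2 * n -> main_inv q s ->
  run p_step s step_cost (fun s => s (inl 6) = q /\ main_inv q.+1 (upd s (inl 6) q.+1)).
Proof.
move=> q2 [F [ls [lo [j [r [ps [mid [k [T [p [dd [h [qu [-> ok tb bhi]]]]]]]]]]]]]].
have r_lt : q %% n < n by rewrite ltn_pmod.
pose r0 := Ordinal r_lt.
(* As q < 2n, the quotient is 0 or 1: it is the phase bit. *)
have late : q %/ n = (n <= q).
  case: leqP => nq; last by rewrite divn_small.
  by apply/eqP; rewrite eqn_leq -ltnS ltn_divLR // q2 divn_gt0.
apply: run_seq; apply: (run_set L_gt0); rewrite !evE /= late.
  by apply: val_small; case: (n <= q); lia.
rewrite upd_reg /=; apply: run_seq; apply: (run_set L_gt0); rewrite !evE /= -late.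
  by apply: val_small; apply: leq_trans (leq_subr _ _) _; lia.
rewrite upd_reg /= late {2}(divn_eq q n) late addKn -[q %% n]/(val r0).
apply: (run_if L_gt0); rewrite !evE /= (Hia r0).
(* The sum of both truncated differences of two bits is their exclusive or. *)
have -> : ((r0 \in A) - (n <= q) + ((n <= q) - (r0 \in A)) != 0) = ((r0 \in A) != (n <= q)).
  by case: (_ \in _); case: (n <= q).
have [ok1 _ _ ok4] := ok.
have [_ _ _ uls mls] := tb.
have Fc (X : {set 'I_n}) : F X != 0 -> #|X| = #|rows A q|.
  move=> FX; apply: (@matchings_card n E); rewrite -lt0n; apply: leq_trans (ok1 X).
  by rewrite lt0n.
case: ifPn => act; last first.
  apply: run_weaken; [apply: (run_skip L_gt0); exact: erefl|by []|].
  move=> s1 _ <-; rewrite St_reg upd_reg /=; split=> //.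
  have act' : (r0 \in A) = (n <= q) by apply/eqP; rewrite negbK in act.
  do 13 eexists; split; first reflexivity.
  - exact: layer_inactive act' ok.
  - by rewrite (rowsS_inactive q2 _ act').
  - by apply: leq_trans bhi _; rewrite leq_add2l leq_mul2r leqnSn orbT.
have okS := layer_active SA leBin leSup q2 (erefl _ : r0 = q %% n :> nat) act ok.
have [rR rS] := rowsS_active q2 (erefl _ : r0 = q %% n :> nat) act.
have bhi' : lo + size ls + 2 ^ n <= (2 * n + 1) * 2 ^ n.
  apply: leq_trans (leq_add bhi (leqnn _)) _.
  have : 0 < 2 ^ n by rewrite expn_gt0.
  by move: q2; move: (2 ^ n) => N; nia.
have lsB : size ls <= B.
  move/card_uniqP: (uls) => <-; apply: leq_trans ok4; apply: subset_leq_card.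
  by apply/subsetP => X; rewrite inE mls.
apply: run_weaken.
- apply: (run_layer (late := n <= q) (r := r0) Hmk Fc _ bhi' lsB tb) => X.
  by have [okS1 _ _ _] := okS; apply: leq_trans (okS1 X) (matchings_bound _ _ _).
- by [].
move=> s1 _ [j1 [mid1 [k1 [T1 [p1 [dd1 [ls1 [h1 [qu1 [-> tb1]]]]]]]]]].
rewrite St_reg upd_reg /=; split=> //.
do 13 eexists; split; first reflexivity.
- exact: okS.
- by rewrite rS cardsU1 rR.
- have [_ _ _ /size_uniq_sets uls1 _] := tb1.
  by rewrite mulSn addnCA addnC leq_add.
Qed.

Lemma run_main j r k T p dd ps mid :
  run p_main (St [:: e; c; j; i0; d; 0; r; ps; 0; mid; 0; k; T; p; dd]
                 (fun=> 0) (fun=> 0) mk ia)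
    (1 + (1 + (2 * n * step_cost.+2).+2)) (main_inv (2 * n)).
Proof.
apply: run_seq; apply: (run_setmem L_gt0); rewrite !evE /=; first by small.
rewrite (@upd_cell _ _ _ _ _ 0 _ _ isT) /=; apply: run_seq; apply: (run_set L_gt0); rewrite !evE /=; first by small.
rewrite upd_reg /=; apply: (run_for L_gt0).
- small.
- by move=> q s _ [F [ls [lo [j1 [r1 [ps1 [mid1 [k1 [T1 [p1 [dd1 [h1 [qu1 [-> _ _ _]]]]]]]]]]]]]]; rewrite !evE.
- by move=> q s q2 Hq; apply: run_step.
- rewrite upd_reg /=.
  have r0 : rows A 0 = set0 by apply/setP => i; rewrite !inE; case: ifP.
  exists (fun X => X == set0 : nat), [:: set0], 0; do 10 eexists; split; first reflexivity.
  + exact: layer_init.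
  + rewrite r0 cards0; split=> //.
    * by move=> X /eqP; rewrite cards_eq0 => /eqP ->; rewrite mask0 eqxx.
    * move=> X; rewrite card_gt0 /fset => /eqP X0; case: eqP => // mX.
      by case: X0; apply: mask_inj; rewrite mX mask0.
    * by move=> x; rewrite ltnS leqn0 => /eqP ->; rewrite mask0.
    * by move=> X; rewrite mem_seq1 eqb0 negbK.
  + by rewrite mul0n.
Qed.

Lemma run_out s : main_inv (2 * n) s ->
  run p_out s (1 + ((n * 3).+2 + 1)) (fun s => output s = #|perfect_matchings E|).
Proof.
move=> [F [ls [lo [j [r [ps [mid [k [T [p [dd [h [qu [-> ok tb _]]]]]]]]]]]]]].
apply: run_seq; apply: (run_set L_gt0); rewrite !evE /=; first by small.
rewrite upd_reg /=; apply: run_seq; apply: run_weaken.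
- apply: (@run_for L W L_gt0 (fun m s => s = St [:: e; c; m; i0; d; 2 * n; r; ps; lo;
      mid; lo + size ls; k; T; 2 ^ m; dd] h qu mk ia) n 1).
  + small.
  + by move=> m s1 _ ->; rewrite !evE.
  + move=> m s1 mn ->; apply: (run_set L_gt0); rewrite !evE /=.
      by apply: val_mask; rewrite -expnS leq_exp2l.
    by rewrite upd_reg St_reg /= upd_reg /= -expnS.
  + by rewrite upd_reg.
- by [].
move=> s1 _ ->.
have rT : rows A (2 * n) = setT.
  by apply/setP => i; rewrite !inE; have := ltn_ord i; case: ifP => _; lia.
have hT : h (2 ^ n - 1) = #|perfect_matchings E|.
  have [hF _ _ _ _] := tb; rewrite -maskT hF ?rT //; exact: layer_final ok.
apply: (run_set L_gt0); rewrite !evE /= hT; last by [].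
by rewrite -matchings_full; apply/val_count/matchings_bound.
Qed.

End MainLoop.

Variable B : nat.
(** The bound must be uniform in [S], which is known only once the selection has run. *)
Hypothesis HB : forall S, selected_upto n S ->
  (forall i, i <= #|nbr E S| -> 'C(n, i) <= B) /\ 2 ^ (n - #|S|) <= B.

Definition prog_cost :=
  (n * (1 + (n * 3).+2 + 1).+2).+2 +
  ((n * (1 + (n * 3).+2 + (1 + (1 + (n * 4).+2)).+1).+2).+2 +
   (1 + (1 + (2 * n * (step_cost B).+2).+2) + (1 + ((n * 3).+2 + 1)))).

Lemma run_prog :
  run prog (input E) prog_cost (fun s => output s = #|perfect_matchings E|).
Proof.
rewrite St_input /=; apply: run_seq; apply: run_weaken.
- exact: run_count.
- by [].
move=> s1 _ [j1 [i1 [d1 ->]]]; apply: run_seq; apply: run_weaken.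
- exact: run_select.
- by [].
move=> s2 _ [S [j2 [i2 [d2 [mk [ia [-> sel Hmk Hia]]]]]]].
have [leBin leSup] := HB sel.
apply: run_seq; apply: run_weaken.
- exact: (run_main leBin leSup Hmk Hia).
- by [].
move=> s3 _; exact: run_out.
Qed.

End Program.

(** * Bounding the time in terms of n and |E| *)

(** The quotient is n / (5 Delta) rounded down, a size the greedy choice is sure to reach. The
    maximum ranges over the set sizes up to 3n/10 of the first phase. *)
Definition states_bound n (E : bigraph n) : nat :=
  2 ^ (n - (n * n) %/ (5 * #|E|)) + \max_(i < n.+1 | 10 * i <= 3 * n) 'C(n, i).

Lemma states_boundP n (E : bigraph n) (S : {set 'I_n}) :
  0 < n -> 3 * n <= #|E| -> selected_upto E n S ->
  (forall i, i <= #|nbr E S| -> 'C(n, i) <= states_bound E) /\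
  2 ^ (n - #|S|) <= states_bound E.
Proof.
move=> n0 nE [S1 S2 _ S4].
have [|cA cS] := selection_bounds n0 nE S1 S2.
  by move=> room j gd; apply: S4.
split=> [i iA|].
  have lei : i < n.+1.
    by rewrite ltnS (leq_trans iA) // -[leqRHS]card_ord max_card.
  apply: leq_trans (leq_addl _ _).
  apply: (leq_bigmax_cond (Ordinal lei)) => /=.
  by apply: leq_trans cA; rewrite leq_mul2l.
apply: leq_trans (leq_addr _ _); rewrite leq_exp2l // leq_sub2l //.
by rewrite -ltnS ltn_divLR 1?mulnC //; lia.
Qed.

(* From C(n, i) <= 3^n / 2^(n - i) and 3^5 <= 2^8. *)
Lemma binomial_max_bound n :
  (\max_(i < n.+1 | 10 * i <= 3 * n) 'C(n, i)) ^ 10 <= 2 ^ (9 * n).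
Proof.
elim/big_ind: _ => [|a b ha hb|i hi]; first by rewrite exp0n.
  by rewrite /maxn; case: ifP.
have h3 : 3 ^ (10 * n) <= 2 ^ (16 * n).
  have -> : 10 * n = 5 * (2 * n) by rewrite mulnA.
  have -> : 16 * n = 8 * (2 * n) by rewrite mulnA.
  by rewrite !(expnM _ _ (2 * n)); case: (2 * n) => // m; rewrite leq_exp2r.
(* The factor 2^(7n) is at most 2^(10 (n - i)), because 10 i <= 3 n. *)
rewrite -(@leq_pmul2r (2 ^ (7 * n))) ?expn_gt0 // -expnD -mulnDl.
apply: leq_trans h3; rewrite [10 * n]mulnC (expnM 3).
apply: leq_trans (_ : ('C(n, i) * 2 ^ (n - i)) ^ 10 <= _).
  rewrite expnMn; apply: leq_mul => //.
  by rewrite -(expnM 2 (n - i) 10) leq_exp2l //; lia.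
by rewrite leq_exp2r // binomial_exp2_bound.
Qed.

(** With a = 2^(n^2) and b = 2^n, each summand is at most a small multiple of a b^2; together they
    stay below 2^7 a b^2. *)
Lemma value_bound n :
  2 ^ (n * n) + (2 * n + 1) * 2 ^ n + n * n + 2 * n + 10 < 2 ^ (n * n + 2 * n + 7).
Proof.
have hn : n < 2 ^ n by rewrite ltn_expl.
have -> : 2 ^ (n * n + 2 * n + 7) = 2 ^ (n * n) * (2 ^ n * 2 ^ n) * 2 ^ 7.
  by rewrite (expnD 2 _ 7) (expnD 2 (n * n)) mul2n -addnn (expnD 2 n n).
have : 0 < 2 ^ (n * n) by rewrite expn_gt0.
move: (2 ^ (n * n)) (2 ^ n) hn => a b hn a0.
have c6 : 0 < b * b by rewrite muln_gt0 (leq_ltn_trans _ hn).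
have c1 : a <= a * (b * b) by rewrite leq_pmulr.
have c2 : b * b <= a * (b * b) by rewrite leq_pmull.
have c3 : n * n <= b * b by nia.
have c4 : (2 * n + 1) * b <= 2 * (b * b) by nia.
have c5 : 2 * n <= 2 * (b * b) by nia.
have -> : 2 ^ 7 = 128 by [].
move: (a * (b * b)) (b * b) c1 c2 c3 c4 c5 c6 => u v; lia.
Qed.

Lemma prog_cost_bound n B : 0 < B -> prog_cost n B <= 200 * n.+1 ^ 2 * B.
Proof.
move=> B0; rewrite /prog_cost /step_cost /state_cost /expand_cost -mulnn.
nia.
Qed.

(** The exponent 6 is 2 from the step count and 4 from L^2, with L quadratic in n. The weight of the
    fixed program goes into the constant. *)
Lemma run_time_bound : exists K : nat, forall n (E : bigraph n),
  0 < n -> 3 * n <= #|E| ->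
  exists s t tr, [/\ exec prog (input E) s t tr, output s = #|perfect_matchings E|
    & t <= K * n.+1 ^ 6 * states_bound E].
Proof.
exists (200 * cmd_weight prog * 100) => n E n0 nE.
set L := n * n + 2 * n + 7.
have L0 : 0 < L by rewrite /L addnS.
have bi : bnd L (input E).
  move=> l; rewrite bitlen_leE //; apply: leq_ltn_trans (value_bound n).
  have : input E l <= n + 1; last by lia.
  by case: l => [[|r]|a] //=; rewrite ?leq_addr // (leq_trans (leq_b1 _)) ?leq_addl.
have HB S := @states_boundP n E S n0 nE.
have [s [t [tr [ex lt _ out]]]] := run_prog L0 n0 (value_bound n) HB bi (leqnn _).
exists s, t, tr; split=> //; apply: leq_trans lt _.
have B0 : 0 < states_bound E by rewrite /states_bound addn_gt0 expn_gt0.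
have hL : L ^ 2 <= 100 * n.+1 ^ 4.
  have -> : 100 * n.+1 ^ 4 = (10 * n.+1 ^ 2) ^ 2 by rewrite expnMn -expnM.
  by rewrite leq_exp2r // /L -mulnn; nia.
apply: leq_trans (leq_mul (prog_cost_bound n B0) (leq_mul (leqnn _) hL)) _.
by rewrite (_ : 6 = 2 + 4) // expnD; move: (n.+1 ^ 2) (n.+1 ^ 4) (cmd_weight prog) => a b c; nia.
Qed.

(** * The real exponent *)

Import Order.TTheory GRing.Theory Num.Theory.
Local Open Scope ring_scope.

Lemma avg_degreeE (R : realType) n (E : bigraph n) :
  avg_degree R E = #|E|%:R / n%:R.
Proof.
rewrite /avg_degree card_sum card_ord addnn -muln2 natrM [2 * _]mulrC -mulf_div.
by rewrite divff ?mulr1 // pnatr_eq0.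
Qed.

Lemma log2_ge1 (R : realType) (x : R) : 2 <= x -> 1 <= log2 x.
Proof.
move=> x2; have ln2_gt0 : 0 < ln (2 : R) by apply: ln_gt0; lra.
by rewrite /log2 ler_pdivlMr // mul1r ler_ln // posrE; lra.
Qed.

(** The constant 3 is 2 + 1: a factor 2 pays for rounding n / (5 Delta) down, and 1 covers the
    binomial part, whose exponent 9/10 is at most 1 - y. *)
Lemma states_bound_powR (R : realType) n (E : bigraph n) :
  let Delta := avg_degree R E in
  (0 < n)%N -> 3 <= Delta ->
  (states_bound E)%:R <= 3 * 2 `^ ((1 - 1 / (5 * Delta * log2 Delta)) * n%:R).
Proof.
move=> Delta n0 D3.
have nR : 0 < n%:R :> R by rewrite ltr0n.
have lD : 1 <= log2 Delta by apply: log2_ge1; lra.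
have ED : #|E|%:R = Delta * n%:R :> R by rewrite /Delta avg_degreeE divfK // gt_eqF.
set y := 1 / (5 * Delta * log2 Delta).
have y_le : y <= 1 / (5 * Delta).
  by rewrite /y !div1r lef_pV2 ?posrE; nra.
have D_le : 1 / (5 * Delta) <= 1 / 10.
  by rewrite !div1r lef_pV2 ?posrE; nra.
set P := 2 `^ _.
have -> : 3 * P = 2 * P + P by ring.
rewrite /states_bound natrD lerD //.
- set k := (_ %/ _)%N.
  have E0 : (0 < #|E|)%N by rewrite -(ltr0n R) ED; nra.
  have kE : (n * n < k.+1 * (5 * #|E|))%N by rewrite -ltn_divLR ?muln_gt0.
  have kR : n%:R / (5 * Delta) <= k.+1%:R :> R.
    rewrite ler_pdivrMr; last by lra.
    have : (n * n)%:R <= (k.+1 * (5 * #|E|))%:R :> R by rewrite ler_nat ltnW.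
    by rewrite !natrM ED; nra.
  have kn : (k <= n)%N.
    have : (k * (5 * #|E|) <= n * n)%N by apply: leq_trunc_div.
    have : (n <= #|E|)%N by rewrite -(ler_nat R) ED; nra.
    nia.
  rewrite natrX -powR_mulrn // natrB //.
  have -> : 2 * P = 2 `^ (1 + (1 - y) * n%:R).
    by rewrite powRD ?powRr1 // pnatr_eq0 implybT.
  apply: ler_powR; first by lra.
  have {}kR : 1 / (5 * Delta) * n%:R <= k%:R + 1 by rewrite natr1 mulrC mulrA mulr1.
  have yk := ler_wpM2r (ltW nR) y_le.
  rewrite mulrBl mul1r; move: (y * n%:R) (1 / (5 * Delta) * n%:R) yk kR => a b; lra.
- have := binomial_max_bound n; set C := \max_(_ < _ | _) _ => hC.
  apply: le_trans (_ : 2 `^ (9 / 10 * n%:R) <= _); last first.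
    by apply: ler_powR; [lra | rewrite ler_pM2r //; lra].
  rewrite -(@ler_pXn2r _ 10) ?nnegrE ?powR_ge0 ?ler0n //.
  rewrite -natrX -[leRHS]powR_mulrn ?powR_ge0 // -powRrM.
  have -> : 9 / 10 * n%:R * 10 = (9 * n)%:R :> R by rewrite natrM; field.
  by rewrite powR_mulrn // -natrX ler_nat.
Qed.

Theorem theorem3 (R : realType) :
  exists (p : cmd) (q : {poly R}) (c : nat),
    forall (n : nat) (E : bigraph n),
      let Delta := avg_degree R E in
      3 <= Delta ->
      exists (s : state) (t : nat) (tr : trace),
        [/\ exec p (input E) s t tr,
            output s = #|perfect_matchings E|,
            t%:R <= q.[n%:R]
                    * 2 `^ ((1 - 1 / (5 * Delta * log2 Delta)) * n%:R)
          & (ram_space tr <= 2 ^ (c * n))%N].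
Proof.
have [K time] := run_time_bound.
(* The 3 comes from [states_bound_powR]. In c, the term 2K absorbs the constant K and the factor 2
   of 2^(n+1), 6 absorbs (n+1)^6, and 1 the remaining 2^n. *)
exists prog, ((3 * K)%:R *: ('X + 1) ^+ 6), (2 * K + 7)%N => n E Delta D3.
(* For n = 0 the average degree is 0 by the convention on division by zero, against Delta >= 3. *)
have n0 : (0 < n)%N.
  by move: D3; rewrite /Delta avg_degreeE; case: n E Delta => // E Delta; rewrite invr0 mulr0; lra.
have nE : (3 * n <= #|E|)%N.
  rewrite -(ler_nat R) natrM -ler_pdivlMr ?ltr0n //; by rewrite -avg_degreeE.
have [s [t [tr [ex out lt]]]] := time n E n0 nE.
exists s, t, tr; split=> //.
  have lB := states_bound_powR n0 D3; rewrite -/Delta in lB.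
  apply: le_trans (_ : (K * n.+1 ^ 6)%:R * (states_bound E)%:R <= _).
    by rewrite -natrM ler_nat.
  rewrite hornerZ horner_exp hornerD hornerX hornerC natr1 -natrX.
  rewrite [(3 * K)%:R]natrM natrM.
  apply: le_trans (ler_wpM2l _ lB) _; first by rewrite -natrM ler0n.
  by rewrite le_eqVlt; apply/orP; left; apply/eqP; ring.
apply: leq_trans (ram_space_exec ex) _; apply: leq_trans lt _.
have lB : (states_bound E <= 2 ^ n.+1)%N.
  rewrite expnS mul2n -addnn leq_add ?leq_exp2l ?leq_subr //.
  apply/bigmax_leqP => i _.
  have -> : (2 ^ n = \sum_(j < n.+1) 'C(n, j))%N.
    by rewrite (expnDn 1 1 n); apply: eq_bigr => j _; rewrite !exp1n !muln1.
  by rewrite (bigD1 i) //= leq_addr.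
have l6 : (n.+1 ^ 6 <= 2 ^ (6 * n))%N by rewrite mulnC expnM leq_exp2r // ltn_expl.
apply: leq_trans (leq_mul (leq_mul (leqnn K) l6) lB) _.
have hK : (2 * K <= 2 ^ (2 * K * n))%N.
  by apply: ltnW; apply: leq_trans (ltn_expl _ (isT : 1 < 2)%N) _; rewrite leq_exp2l // leq_pmulr.
rewrite mulnDl expnD (_ : 7 * n = 6 * n + n)%N; last by lia.
rewrite expnD expnS.
apply: leq_trans (_ : (2 * K * (2 ^ (6 * n) * 2 ^ n) <= _))%N; last by rewrite leq_mul2r hK orbT.
by move: (2 ^ (6 * n))%N (2 ^ n)%N => a b; rewrite leq_eqVlt; apply/orP; left; apply/eqP; ring.
Qed.
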